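(* Let $g\ge 1$ and $N\geq 2g+1$ be integers, and let $X=X_{P,Q}$ be a hyperelliptic curve of genus $g$ over an algebraically closed field $k$ of characteristic $p\ge 0$, with affine model $y^2+Q(x)y=P(x)$, embedded in its jacobian $J$ with the point at infinity $\infty$ as base point. Let $\Delta_{\mathsf P,\mathsf Q,N}(\mathsf x)\in\Lambda[\mathsf x]$ be the universal polynomial and $\varDelta_N(x)\in k[x]$ its specialization to $X_{P,Q}$, both defined in the context. (a) Define $$\delta_{N,g}=\begin{cases} g(N+2)(N-2g)/2 & \text{if } N\geq 2g+2 \text{ is even},\\ g(N+1)(N-2g+1)/2 & \text{if } N\geq 2g+1 \text{ is odd}.\end{cases}$$ Then $\Delta_{\mathsf P,\mathsf Q,N}(\mathsf x)$ has degree $\delta_{N,g}$ as a polynomial in $\mathsf x$. Hence $\varDelta_N(x)$ has degree at most $\delta_{N,g}$. Furthermore, $\tilde U_N(x)^g$ divides $\varDelta_N(x)$. (b) In particular, if $\varDelta_N(x)\neq 0$, then $\sharp (X\cap \tilde J[N])\leq 2\,\frac{\deg(\varDelta_N(x))}{g}$. (c) Suppose that $p=0$ or $p>N$. Then $\varDelta_N(x)$ has degree equal to $\delta_{N,g}$. In particular $\varDelta_N(x)\neq 0$, and so $$\sharp (X\cap\tilde J[N])\leq\begin{cases}(N+2)(N-2g) & \text{if } N\geq 2g+2 \text{ is even},\\ (N+1)(N-2g+1) & \text{if } N\geq 2g+1 \text{ is odd}.\end{cases}$$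
   Context: Curve: $k$ is algebraically closed of characteristic $p\ge0$; $P\in k[x]$ is monic of degree $2g+1$, $Q\in k[x]$ has degree at most $g$, and the affine curve $y^2+Q(x)y=P(x)$ is smooth; $X=X_{P,Q}$ is its smooth projective completion, obtained by adding one point $\infty$ (a Weierstrass point), of genus $g$ (for $g=1$ it is an elliptic curve). $X$ is viewed as a subset of its jacobian $J$ via $\xi\mapsto$ class of $[\xi]-[\infty]$. $J[N]$ is the subgroup of $J(k)$ of points of order dividing $N$ and $\tilde J[N]=J[N]\setminus J[2]$. Let $\tilde{\mathcal T}_N$ be the set of $x_0\in k$ such that the points $(x_0,y_0)$ and $(x_0,-Q(x_0)-y_0)$ of $X$ with $x$-coordinate $x_0$ lie in $\tilde J[N]$ (one lies in it iff the other does), and $\tilde U_N(x)=\prod_{x_0\in\tilde{\mathcal T}_N}(x-x_0)$. Universal objects: let $\Lambda=\mathbb Z[p_0,\dots,p_{2g},q_0,\dots,q_g]$ (polynomial ring), $\mathsf P(\mathsf x)=p_0+p_1\mathsf x+\cdots+p_{2g}\mathsf x^{2g}+\mathsf x^{2g+1}$, $\mathsf Q(\mathsf x)=q_0+\cdots+q_g\mathsf x^g$, $\mathsf F=4\mathsf P+\mathsf Q^2$. Consider $\Lambda[\mathsf x,\mathsf y]$ with $\mathsf y^2+\mathsf Q(\mathsf x)\mathsf y=\mathsf P(\mathsf x)$; then $(2\mathsf y+\mathsf Q)^2=\mathsf F$. On its fraction field let $\mathsf D_1$ be the unique derivation vanishing on $\Lambda$ with $\mathsf D_1\mathsf x=1$,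 and $\mathsf D_n=\mathsf D_1^n/n!$. For $i\ge 0$, $n\ge1$ there are unique $\mathsf s_{i,n},\mathsf t_{i,n}\in\Lambda[\mathsf x]$ with $\mathsf D_n(\mathsf x^i\mathsf y)=(\mathsf s_{i,n}+\mathsf t_{i,n}\mathsf y)/(2\mathsf y+\mathsf Q)^{2n-1}$. Put $\mu=\lfloor (N-2g-1)/2\rfloor$, $\nu=\lfloor N/2\rfloor+1$, and let $\Gamma_N(\mathsf x)$ be the determinant of the $(\mu+1)\times(\mu+1)$ matrix with entries $\mathsf s_{i,n}$, rows $0\le i\le\mu$, columns $\nu\le n\le\nu+\mu$. Then $\mathsf F^{\mu(\mu+1)/2}$ divides $\Gamma_N$ in $\Lambda[\mathsf x]$, and $\Delta_{\mathsf P,\mathsf Q,N}(\mathsf x):=\Gamma_N(\mathsf x)/\mathsf F(\mathsf x)^{\mu(\mu+1)/2}$. The specialization $\varDelta_N(x)=\varDelta_{P,Q,N}(x)$ is the image of $\Delta_{\mathsf P,\mathsf Q,N}$ under the ring homomorphism $\Lambda[\mathsf x]\to k[x]$ sending $\mathsf x\mapsto x$ and each $p_i$, $q_i$ to the coefficient of $x^i$ in $P$, $Q$ respectively. *)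

(* Defs.v *)
From HB Require Import structures.
From mathcomp Require Import all_boot all_order all_algebra qfpoly zify.
From mathcomp Require Import boolp classical_sets cardinality fsbigop.
From mathcomp.multinomials Require Import freeg mpoly.

Set Implicit Arguments.
Unset Strict Implicit.
Unset Printing Implicit Defensive.

Import Order.TTheory GRing.Theory Num.Theory.

Local Open Scope ring_scope.
Local Open Scope classical_set_scope.

Lemma fractionP (R : idomainType) (u : {fraction R}) :
  exists a b : R, b != 0 /\
    u = FracField.tofrac a / FracField.tofrac b.
Proof.
elim/quotW: u => f; exists (\n_f), (\d_f); have d0 := denom_ratioP f.
split=> //; apply: (canRL (mulfK _)); first by rewrite tofrac_eq0.
rewrite -[_ * _]/(FracField.mul _ _) !piE; apply/eqmodP => /=.
rewrite FracField.equivfE /FracField.mulf.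
by rewrite !numden_Ratio ?mulf_neq0 ?oner_neq0 //= !mulr1 mulrC.
Qed.

Record weierstrass (R : idomainType) (g : nat) := Weierstrass {
  wP : {poly R};
  wQ : {poly R};
  wP_monic : wP \is monic;
  wP_size : size wP = (2 * g + 1).+1%N;
  wQ_size : (size wQ <= g.+1)%N
}.

Section FunctionField.
Context (R : idomainType) (g : nat) (E : weierstrass R g).

Definition wfrac (p : {poly R}) : {fraction {poly R}} := FracField.tofrac p.

Definition weq : {poly {fraction {poly R}}} :=
  'X^2 + (wfrac (wQ E))%:P * 'X - (wfrac (wP E))%:P.

Lemma size_weq : size weq = 3.
Proof.
rewrite /weq -addrA size_polyDl ?size_polyXn// ltnS.
rewrite (leq_trans (size_polyD _ _))// geq_max size_polyN.
rewrite [X in _ && X](leq_trans (size_polyC_leq1 _))// andbT.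
rewrite (leq_trans (size_polyMleq _ _))// size_polyX addn2/=.
by rewrite ltnS size_polyC_leq1.
Qed.

Lemma weq_monic : weq \is monic.
Proof.
rewrite monicE lead_coefE size_weq /weq !coefD coefN coefXn coefCM coefX coefC/=.
by rewrite mulr0 subr0 addr0.
Qed.

Lemma weq_root_free f : ~~ root weq f.
Proof.
have [a [b [b0 ->]]] := fractionP f; apply/negP => /rootP.
have tb0 : FracField.tofrac b != 0 by rewrite tofrac_eq0.
rewrite /weq !hornerE => /(congr1 ( *%R^~ (FracField.tofrac b ^+ 2))).
rewrite mul0r !mulrDl expr_div_n divfK ?expf_neq0// => h.
have {h} /eqP : a ^+ 2 + wQ E * a * b = wP E * b ^+ 2.
  apply/eqP; rewrite -(tofrac_eq _) !(tofracD, tofracM, tofracXn).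
  rewrite -subr_eq0 -h mulNr; apply/eqP; congr (_ + _ - _).
  by rewrite /= expr2 mulrA divfK.
have P0 : wP E != 0 by rewrite -size_poly_gt0 wP_size.
have sP := wP_size E; have sQ := wQ_size E.
have sb0 : (0 < size b)%N by rewrite size_poly_gt0.
have sR : size (wP E * b ^+ 2) = (2 * g + 1 + (size b).*2).-1.
  by rewrite size_mul ?expf_neq0// expr2 size_mul// sP -addnn; lia.
have sA : size (a ^+ 2) = (size a).*2.-1.
  by have [->|a0] := eqVneq a 0; rewrite ?expr0n ?size_poly0 //
    expr2 size_mul// addnn.
have sM : (size (wQ E * a * b)%R <= g + size a + size b - 1)%N.
  apply: (leq_trans (size_polyMleq _ _)).
  by have := size_polyMleq (wQ E) a; lia.
move=> /eqP /(congr1 (fun p : {poly R} => size p)); rewrite sR.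
have [big|small] := leqP (g + size b + 1) (size a).
  rewrite size_polyDl sA; first by lia.
  by apply: (leq_ltn_trans sM); lia.
have := size_polyD (a ^+ 2) (wQ E * a * b); rewrite sA => sD sE.
by move: sD; rewrite sE; lia.
Qed.

Lemma weq_irreducible : monic_irreducible_poly weq.
Proof.
split; last exact: weq_monic.
by apply: cubic_irreducible; [rewrite size_weq | exact: weq_root_free].
Qed.

(* The fraction field of R[x, y] / (y ^ 2 + Q y - P). *)
Definition funfield : fieldType := {poly %/ weq with weq_irreducible}.

Definition fpoly (p : {poly R}) : funfield :=
  qfpoly_const weq_irreducible (wfrac p).
Definition fconst (c : R) : funfield := fpoly c%:P.
Definition fx : funfield := fpoly 'X.
Definition fy : funfield := in_qpoly weq 'X.

Fact fpoly_is_zmod_morphism : zmod_morphism fpoly.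
Proof.
by move=> a b; rewrite /fpoly /wfrac tofracB; exact: qpolyC_is_zmod_morphism.
Qed.

Fact fpoly_is_monoid_morphism : monoid_morphism fpoly.
Proof.
rewrite /fpoly /wfrac; split; first by rewrite tofrac1.
by move=> a b; rewrite tofracM; exact: (qpolyC_is_monoid_morphism weq).2.
Qed.

HB.instance Definition _ :=
  GRing.isZmodMorphism.Build {poly R} funfield fpoly fpoly_is_zmod_morphism.
HB.instance Definition _ :=
  GRing.isMonoidMorphism.Build {poly R} funfield fpoly fpoly_is_monoid_morphism.

HB.instance Definition _ := GRing.RMorphism.copy fconst (fpoly \o polyC).
End FunctionField.

Section Universal.
Context (g : nat).

(* The first 2g+1 variables are p_0, ..., p_2g; the last g+1 are q_0, ..., q_g. *)
Definition Lambda : idomainType := {mpoly int[2 * g + 1 + g.+1]}.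

Definition univP : {poly Lambda} :=
  'X^(2 * g + 1) +
  \sum_(i < 2 * g + 1) ('X_(lshift g.+1 i) : Lambda)%:P * 'X^i.
Definition univQ : {poly Lambda} :=
  \sum_(i < g.+1) ('X_(rshift (2 * g + 1) i) : Lambda)%:P * 'X^i.

Lemma size_sum_polyCX n (c : 'I_n -> Lambda) :
  (size (\sum_(i < n) (c i)%:P * 'X^i)%R <= n)%N.
Proof.
apply: (leq_trans (size_sum _ _ _)); apply/bigmax_leqP => i _.
by rewrite mul_polyC (leq_trans (size_scale_leq _ _))// size_polyXn.
Qed.

Lemma size_univP : size univP = (2 * g + 1).+1.
Proof. by rewrite /univP size_polyDl size_polyXn// ltnS size_sum_polyCX. Qed.

Lemma univP_monic : univP \is monic.
Proof.
rewrite /univP monicE lead_coefDl ?lead_coefXn// size_polyXn ltnS.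
exact: size_sum_polyCX.
Qed.

Lemma size_univQ : (size univQ <= g.+1)%N.
Proof. exact: size_sum_polyCX. Qed.

Definition univ : weierstrass Lambda g :=
  Weierstrass univP_monic size_univP size_univQ.

Definition univF : {poly Lambda} := 4%:R * univP + univQ ^+ 2.

Local Notation K := (funfield univ).

Definition is_D1 (D : K -> K) : Prop :=
  [/\ forall u v, D (u + v) = D u + D v,
      forall u v, D (u * v) = D u * v + u * D v,
      forall c, D (fconst univ c) = 0
    & D (fx univ) = 1].

Definition D1 : K -> K := xget (fun=> 0) [set D | is_D1 D].

Definition Dn (n : nat) (u : K) : K := iter n D1 u / (n`!)%:R.

Definition is_st (i n : nat) (st : {poly Lambda} * {poly Lambda}) : Prop :=
  Dn n (fx univ ^+ i * fy univ) =
  (fpoly univ st.1 + fpoly univ st.2 * fy univ)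
    / (2%:R * fy univ + fpoly univ univQ) ^+ (2 * n - 1).

Definition s_ (i n : nat) : {poly Lambda} := (xget 0 [set st | is_st i n st]).1.

Definition mu (N : nat) : nat := (N - (2 * g + 1)) %/ 2.
Definition nu (N : nat) : nat := (N %/ 2).+1.

Definition Gamma (N : nat) : {poly Lambda} :=
  \det (\matrix_(i < (mu N).+1, j < (mu N).+1) s_ i (nu N + j)).

Definition Delta (N : nat) : {poly Lambda} :=
  xget 0 [set d | Gamma N = d * univF ^+ (mu N * (mu N).+1 %/ 2)].

End Universal.

Definition specialize (k : idomainType) (g : nat) (E : weierstrass k g) :
    {poly Lambda g} -> {poly k} :=
  map_poly (mmap intr (fun i : 'I_(2 * g + 1 + g.+1) =>
    match split i with inl j => (wP E)`_j | inr j => (wQ E)`_j end)).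

Definition delta (g N : nat) : nat :=
  if odd N then (g * (N + 1) * (N - 2 * g + 1) %/ 2)%N
  else (g * (N + 2) * (N - 2 * g) %/ 2)%N.

Section Curve.
Context (k : closedFieldType) (g : nat) (E : weierstrass k g).

Definition on_curve (a : k * k) : bool :=
  a.2 ^+ 2 + (wQ E).[a.1] * a.2 == (wP E).[a.1].

Definition smooth : Prop := forall a, on_curve a ->
  ~ (2%:R * a.2 + (wQ E).[a.1] = 0 /\
     (wQ E)^`().[a.1] * a.2 - (wP E)^`().[a.1] = 0).

Definition affine_point := {a : k * k | on_curve a}.

(* [None] is the point at infinity. *)
Definition point := option affine_point.

Local Notation K := (funfield E).

(* [ev2 p c d] and [fev2 p a b] are the values of p(X, Y), a polynomial in Y
   over k[X], at (c, d) and at (a, b). *)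
Definition ev2 (p : {poly {poly k}}) (c d : k) : k := p.[d%:P].[c].
Definition fev2 (p : {poly {poly k}}) (a b : K) : K :=
  (map_poly (map_poly (fconst E)) p).[b%:P].[a].

(* Coordinate functions around a point, with their values there.  At infinity,
   u = 1 / x and v = y / x ^ (g + 1) satisfy
     v ^ 2 + u ^ (g + 1) Q(1 / u) v = u ^ (2 g + 2) P(1 / u),
   which is smooth at (0, 0). *)
Definition chart (xi : point) : (K * K) * (k * k) :=
  if xi is Some a then ((fx E, fy E), val a)
  else (((fx E)^-1, fy E / fx E ^+ g.+1), (0, 0)).

Definition local_ring (xi : point) : set K :=
  [set f | exists p q, let: ((a, b), (c, d)) := chart xi in
     ev2 q c d != 0 /\ f = fev2 p a b / fev2 q a b].

Definition max_ideal (xi : point) : set K :=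
  [set f | exists p q, let: ((a, b), (c, d)) := chart xi in
     [/\ ev2 q c d != 0, ev2 p c d = 0 & f = fev2 p a b / fev2 q a b]].

Definition uniformizer (xi : point) (t : K) : Prop :=
  [/\ t != 0, max_ideal xi t &
      forall f, max_ideal xi f -> exists2 h, local_ring xi h & f = h * t].

Definition local_unit (xi : point) (u : K) : Prop :=
  [/\ u != 0, local_ring xi u & local_ring xi u^-1].

(* [f] has order [n] at [xi].  Meaningful for smooth [E]: its local rings are
   discrete valuation rings, so uniformizers exist, and the condition does not
   depend on which one is taken. *)
Definition has_order (xi : point) (f : K) (n : int) : Prop :=
  forall t, uniformizer xi t -> local_unit xi (f / t ^ n).

Definition is_div (f : K) (D : {freeg point}) : Prop :=
  f != 0 /\ forall xi, has_order xi f (coeff xi D).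

Definition deg0 : {pred {freeg point}} := fun D => deg D == 0.

Fact deg0_zmod_closed : zmod_closed deg0.
Proof.
split=> [|D1 D2]; rewrite /deg0 !unfold_in; first by rewrite raddf0.
by rewrite raddfB /= => /eqP -> /eqP ->; rewrite subrr.
Qed.

HB.instance Definition _ :=
  GRing.isZmodClosed.Build {freeg point} deg0 deg0_zmod_closed.

Record div0 := Div0 { div0_val :> {freeg point}; _ : div0_val \in deg0 }.
HB.instance Definition _ := [isSub for div0_val].
HB.instance Definition _ := [Choice of div0 by <:].
HB.instance Definition _ := [SubChoice_isSubZmodule of div0 by <:].

Definition principal : {pred div0} :=
  fun D => `[< exists f, is_div f (div0_val D) >].

Lemma fev2_is_rmorph (a b : K) : exists h : {rmorphism {poly {poly k}} -> K},
  forall p, fev2 p a b = h p.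
Proof.
by exists (horner_eval a \o (horner_eval b%:P \o
            map_poly (map_poly (fconst E)))).
Qed.

Lemma ev2_is_rmorph (c d : k) : exists h : {rmorphism {poly {poly k}} -> k},
  forall p, ev2 p c d = h p.
Proof. by exists (horner_eval c \o horner_eval d%:P). Qed.

Lemma local_ring1 xi : local_ring xi 1.
Proof.
exists 1, 1; case: (chart xi) => -[a b] [c d].
have [h hE] := fev2_is_rmorph a b; have [e eE] := ev2_is_rmorph c d.
by rewrite hE eE !rmorph1 oner_neq0 divr1.
Qed.

Lemma local_ringM xi f1 f2 :
  local_ring xi f1 -> local_ring xi f2 -> local_ring xi (f1 * f2).
Proof.
rewrite /local_ring /=; case: (chart xi) => -[a b] [c d].
move=> [p1 [q1 [q1n0 ->]]] [p2 [q2 [q2n0 ->]]].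
exists (p1 * p2), (q1 * q2).
have [h hE] := fev2_is_rmorph a b; have [e eE] := ev2_is_rmorph c d.
rewrite !hE eE !rmorphM -!eE mulf_neq0//; split=> //.
by rewrite invfM mulrACA.
Qed.

Lemma local_unit1 xi : local_unit xi 1.
Proof. by split; rewrite ?invr1 ?oner_neq0//; exact: local_ring1. Qed.

Lemma local_unit_div xi u1 u2 :
  local_unit xi u1 -> local_unit xi u2 -> local_unit xi (u1 / u2).
Proof.
move=> [u1n0 u1O u1VO] [u2n0 u2O u2VO]; split.
- by rewrite mulf_neq0 ?invr_eq0.
- exact: local_ringM.
- by rewrite invf_div mulrC; exact: local_ringM.
Qed.

Fact principal_zmod_closed : zmod_closed principal.
Proof.
split=> [|D1 D2]; rewrite !unfold_in.
  apply/asboolP; exists 1; split=> [|xi t _]; first exact: oner_neq0.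
  by rewrite raddf0 expr0z divr1; exact: local_unit1.
move=> /asboolP[f1 [f1n0 f1D]] /asboolP[f2 [f2n0 f2D]].
apply/asboolP; exists (f1 / f2); split=> [|xi t tP].
  by rewrite mulf_neq0 ?invr_eq0.
have tn0 : t != 0 by case: tP.
have := local_unit_div (f1D xi t tP) (f2D xi t tP).
have -> : coeff xi (div0_val (D1 - D2)) =
    coeff xi (div0_val D1) - coeff xi (div0_val D2) by rewrite -raddfB.
by rewrite expfzDr// -invr_expz !invfM !invrK mulrACA.
Qed.

HB.instance Definition _ :=
  GRing.isZmodClosed.Build div0 principal principal_zmod_closed.

(* The group J(k) = Pic^0(X) of degree zero divisors modulo principal ones. *)
Definition jacobian : zmodType := Quotient.quot principal.

Fact deg_aj (xi : point) : << xi >> - << None >> \in deg0.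
Proof. by rewrite unfold_in raddfB /= !degU subrr. Qed.

(* The embedding of X in its jacobian with base point at infinity. *)
Definition aj (xi : point) : jacobian :=
  (\pi_(Quotient.quot principal) (Div0 (deg_aj xi)))%qT.

Definition torsion (N : nat) : set jacobian := [set c | c *+ N = 0].

Definition torsion_tilde (N : nat) : set jacobian := torsion N `\` torsion 2.

(* The points of X in \tilde J[N]. *)
Definition curve_torsion (N : nat) : set point := aj @^-1` torsion_tilde N.

Definition torsion_x (N : nat) : set k :=
  [set x0 | forall a : affine_point,
     (val a).1 = x0 -> curve_torsion N (Some a)].

(* The library sets the product to 1 when the index set is infinite; this does
   not happen for smooth [E], where J[N] is finite. *)
Definition tildeU (N : nat) : {poly k} :=
  \big[*%R/1]_(x0 \in torsion_x N) ('X - x0%:P).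

End Curve.

Arguments principal {k g} E _.
Arguments jacobian {k g} E.
Arguments torsion {k g} E N _.
Arguments torsion_tilde {k g} E N _.
Arguments curve_torsion {k g} E N _.
Arguments torsion_x {k g} E N _.

Definition characteristic (k : nzRingType) (p : nat) : Prop :=
  if p is 0 then [pchar k] =i pred0 else p \in [pchar k].

(* Main.v *)
Require Import Defs.
From HB Require Import structures.
From mathcomp Require Import all_boot all_order all_algebra.
From mathcomp Require Import finmap boolp classical_sets cardinality.
From mathcomp Require Import perm qpoly qfpoly generic_quotient fsbigop zify ring.
From mathcomp.multinomials Require Import freeg mpoly.

Set Implicit Arguments.
Unset Strict Implicit.
Unset Printing Implicit Defensive.

Import Order.TTheory GRing.Theory Num.Theory.

Local Open Scope ring_scope.

(** Write w = 2y + Q and F = 4P + Q^2 = w^2, and let D_n be the n-th Hasse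
   derivative in x, so that f(x + T) is the sum of the D_n(f) T^n.

   Divisibility.  If a = (x0, y0) is an N-torsion point outside J[2], some
   function u has divisor N[a] - N[oo].  Regularity at the affine points makes
   it A(x) + B(x) y (affine_regular), and since A and B y have orders of opposite
   parities at infinity, deg A <= N/2 and deg B <= mu (pole_bound).  As a is not
   2-torsion, w(a) <> 0 and x - x0 is a local parameter.  For n >= nu > deg A one
   has D_n(u) = sum_i D_i(B) D_(n-i)(y), and D_n(u) vanishes to order N - n at a.
   There are mu + 1 consecutive columns nu <= n <= nu + mu, on all of which the
   order of vanishing is at least N - nu - mu = g.  Hence the rows of the matrix
   of the D_(n-i)(y) are dependent modulo (x - x0)^g, with one coefficient equal
   to the leading coefficient of B, and the adjugate formula gives
   (x - x0)^g | det (det_multiplicity).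

   The determinant.  Expanding (y + Z)^2 + Q(x + T) (y + Z) = P(x + T) in powers
   of T expresses w^(2n-1) D_n(y) as s_n + t_n y with s_n and t_n universal
   polynomials in x (solution_numerators).  For n > g, D_n(Q) = 0, so 2 D_n(y) is
   D_n(w), a rational function of x times w; thus t_n = 0 (numerators_exist).
   Leibniz' rule for x^i y factors the matrix of Gamma as a triangular matrix with
   diagonal entries F^i times the Toeplitz matrix of the s_(n-i), so that
   Delta = det(s_(nu+j-i)) (universal_numerators).  The same formulas hold over
   any base, including characteristic 2, because the s_n are obtained without
   dividing.

   The degree.  For n > g, s_n is half of F^n D_n(sqrt F) / sqrt F, whose term of
   highest degree is that of the binomial series of 2 x^(g+1/2): s_n has degree
   2gn and leading coefficient 2^(2n-1) binom(g+1/2, n).  The leading coefficient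
   of Delta is therefore a Toeplitz determinant of binomial coefficients, which
   factors completely by Vandermonde's identity (det_gbin_toeplitz_neq0) into odd
   numbers of absolute value at most N, powers of 2 and ratios of factorials j!
   with j <= N: it is nonzero in characteristic 0 or p > N.

   The count.  At most two points lie over each x0, and the (x - x0)^g are
   pairwise coprime divisors of the specialization of Delta. *)

(** * Toeplitz determinants of binomial coefficients *)

Section BinomialDeterminant.
Context {K : fieldType}.
Implicit Types (a : K) (i j l m n : nat).

Definition falling a n : K := \prod_(j < n) (a - j%:R).

Definition gbin a n : K := falling a n / n`!%:R.

Lemma fallingS a n : falling (a + 1) n.+1 = (a + 1) * falling a n.
Proof.
rewrite /falling big_ord_recl subr0; congr (_ * _); apply: eq_bigr => i _.
by rewrite lift0 -addn1 natrD opprD addrACA subrr addr0.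
Qed.

Lemma fallingD a m n :
  falling a (m + n) = falling a m * falling (a - m%:R) n.
Proof.
rewrite /falling big_split_ord; congr (_ * _); apply: eq_bigr => i _ /=.
by rewrite natrD opprD addrA.
Qed.

Lemma fact_neq0_le n : (forall m, (0 < m <= n)%N -> m%:R != 0 :> K) ->
  n`!%:R != 0 :> K.
Proof.
elim: n => [_|n IH nz]; first by rewrite oner_neq0.
rewrite factS natrM; apply: mulf_neq0; first by rewrite nz/=.
by apply: IH => m /andP[m0 mn]; rewrite nz// m0 ltnW.
Qed.

Lemma gbin_pascal a n : (forall m, (0 < m <= n.+1)%N -> m%:R != 0 :> K) ->
  gbin (a + 1) n.+1 = gbin a n.+1 + gbin a n.
Proof.
move=> nz; have nz1 := fact_neq0_le nz.
have nz0 : n.+1%:R != 0 :> K by rewrite nz ?ltnSn.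
rewrite /gbin fallingS /falling big_ord_recr/= factS natrM.
have nz2 : n`!%:R != 0 :> K.
  by apply: contraNneq nz1; rewrite factS natrM => ->; rewrite mulr0.
by field; rewrite nz2 addrC natr1.
Qed.

(** binom(a, n - l), extended by 0 to negative n - l: truncated subtraction would
   give 1 there. *)
Definition gbin_shift a n l : K := if (l <= n)%N then gbin a (n - l) else 0.

Lemma gbin_shift_pascal a n l : (forall m, (0 < m <= n)%N -> m%:R != 0 :> K) ->
  gbin_shift (a + 1) n l = gbin_shift a n l + gbin_shift a n l.+1.
Proof.
move=> nz; rewrite /gbin_shift.
have [lt_nl|lt_ln|->] := ltngtP n l; last 1 first.
- by rewrite subnn addr0 /gbin /falling !big_ord0.
- by rewrite addr0.
have -> : (n - l = (n - l.+1).+1)%N by lia.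
by apply: gbin_pascal => m m_le; apply: nz; lia.
Qed.

(** Pascal's rule iterated i times; the upper bound m on l is arbitrary beyond i so
   that the sum can be read as a matrix product. *)
Lemma gbin_vandermonde a n i m : (forall j, (0 < j <= n)%N -> j%:R != 0 :> K) ->
  (i < m)%N ->
  \sum_(l < m) 'C(i, l)%:R * gbin_shift a n l = gbin (a + i%:R) n.
Proof.
move=> nz; elim: i m a => [|i IH] [//|m] a lt_im.
  rewrite big_ord_recl big1 ?addr0 => [|l _]; last by rewrite mul0r.
  by rewrite mul1r /gbin_shift subn0.
rewrite -[i.+1%:R]natr1 addrA addrAC -(IH m.+1) ?(ltnW lt_im)//.
under [RHS]eq_bigr do rewrite gbin_shift_pascal// mulrDr.
rewrite big_split/= big_ord_recl/= [in RHS]big_ord_recl/=.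
rewrite [X in _ = _ + X]big_ord_recr/= ['C(i, m)]bin_small//.
rewrite mul0r addr0 -addrA; congr (_ * _ + _); first by rewrite !bin0.
rewrite -big_split; apply: eq_bigr => l _ /=.
by rewrite -mulrDl binS natrD.
Qed.

Definition pascal_mx m : 'M[K]_m := \matrix_(i, l) 'C(i, l)%:R.

Lemma det_pascal_mx m : \det (pascal_mx m) = 1.
Proof.
rewrite det_trig.
  by apply: big1 => i _; rewrite mxE binn.
by apply/is_trig_mxP => i j lt_ij; rewrite mxE bin_small.
Qed.

(** By Vandermonde the matrix is the product of two unitriangular matrices, of
   entries 'C(i, l) and binom(b, j - l). *)
Lemma det_gbin_column b m : (forall j, (0 < j < m)%N -> j%:R != 0 :> K) ->
  \det (\matrix_(i < m, j < m) gbin (b + i%:R) j) = 1.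
Proof.
move=> nz; pose U := \matrix_(l < m, j < m) gbin_shift b j l.
rewrite (_ : \matrix_(i, j) _ = pascal_mx m *m U).
  rewrite det_mulmx det_pascal_mx mul1r -det_tr det_trig.
    apply: big1 => i _; rewrite !mxE /gbin_shift leqnn subnn.
    by rewrite /gbin /falling big_ord0 divr1.
  by apply/is_trig_mxP => i j lt_ij; rewrite !mxE /gbin_shift leqNgt lt_ij.
apply/matrixP => i j; rewrite !mxE.
under eq_bigr do rewrite !mxE.
by rewrite gbin_vandermonde// => l ?; apply: nz; have := ltn_ord j; lia.
Qed.

(** Multiplying on the left by the unitriangular Pascal matrix turns the entry
   binom(a, n + j - i) into binom(a + i, n + j), which is a factor depending on i,
   times binom(a - n + i, j), times a factor depending on j. *)
Lemma det_gbin_toeplitz_neq0 a n m : (m <= n)%N ->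
  (forall j, (0 < j <= n + m)%N -> j%:R != 0 :> K) ->
  (forall i, (i <= m)%N -> falling (a + i%:R) n != 0) ->
  \det (\matrix_(i < m.+1, j < m.+1) gbin a (n + j - i)) != 0.
Proof.
move=> le_mn nz nz_ff; set T := \matrix_(i, j) _.
pose B := \matrix_(i < m.+1, j < m.+1) gbin (a - n%:R + i%:R) j.
pose r := \row_(i < m.+1) falling (a + i%:R) n.
pose c := \row_(j < m.+1) (j`!%:R / (n + j)`!%:R : K).
have fact_nz j : (j <= n + m)%N -> j`!%:R != 0 :> K.
  by move=> le_j; apply: fact_neq0_le => l ?; apply: nz; lia.
have E : pascal_mx m.+1 *m T = diag_mx r *m B *m diag_mx c.
  apply/matrixP => i j; rewrite mul_mx_diag mul_diag_mx !mxE.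
  have lt_i := ltn_ord i; have lt_j := ltn_ord j.
  have -> : \sum_l pascal_mx m.+1 i l * T l j =
      \sum_(l < m.+1) 'C(i, l)%:R * gbin_shift a (n + j) l.
    apply: eq_bigr => l _; rewrite !mxE /gbin_shift.
    by case: leqP => //; have := ltn_ord l; lia.
  rewrite gbin_vandermonde//; last by move=> l l_le; apply: nz; lia.
  rewrite /gbin fallingD.
  have -> : a - n%:R + i%:R = a + i%:R - n%:R by rewrite addrAC.
  have j_nz : j`!%:R != 0 :> K by apply: fact_nz; lia.
  have nj_nz : (n + j)`!%:R != 0 :> K by apply: fact_nz; lia.
  by field; rewrite j_nz nj_nz.
have := congr1 determinant E; rewrite !det_mulmx det_pascal_mx mul1r => ->.
rewrite det_gbin_column; last by move=> j ?; apply: nz; lia.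
rewrite mulr1 !det_diag mulf_neq0//; apply/prodf_neq0 => i _; rewrite mxE.
  by apply: nz_ff; rewrite -ltnS ltn_ord.
by rewrite mulf_neq0 ?invr_eq0 ?fact_nz//; have := ltn_ord i; lia.
Qed.

End BinomialDeterminant.

(** * Hasse derivatives of polynomials *)

Section HasseDerivatives.
Context {R : comNzRingType}.
Implicit Types p q : {poly R}.

Lemma nderivnM p q n :
  (p * q)^`N(n) = \sum_(j < n.+1) p^`N(j) * q^`N(n - j).
Proof.
elim/poly_ind: p n => [|p c IH] n.
  by rewrite mul0r raddf0 big1// => j _; rewrite raddf0 mul0r.
rewrite mulrDl mulrAC raddfD /= mul_polyC linearZ/= -mul_polyC.
case: n => [|n].
  by rewrite big_ord1 !nderivn0 mulrDl mulrAC.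
have -> : (p * q * 'X)^`N(n.+1) = (p * q)^`N(n) + (p * q)^`N(n.+1) * 'X.
  by have := nderivnMXaddC n (p * q) 0; rewrite addr0.
rewrite !IH [X in X * 'X]big_ord_recl/= [RHS]big_ord_recl/= !nderivn0 !subn0.
rewrite [X in _ = _ + X](eq_bigr (fun j : 'I_n.+1 =>
  p^`N(j) * q^`N(n - j) + p^`N(j.+1) * q^`N(n - j) * 'X)); last first.
  by move=> j _; rewrite nderivnMXaddC mulrDl mulrAC.
rewrite big_split/= -mulr_suml; ring.
Qed.

Lemma nderivn_shift p c n : (p \Po ('X + c%:P))^`N(n) = p^`N(n) \Po ('X + c%:P).
Proof.
elim/poly_ind: p n => [|p a IH] n; first by rewrite !(raddf0, comp_poly0).
rewrite comp_poly_MXaddC; case: n => [|n].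
  by rewrite !nderivn0 comp_poly_MXaddC.
rewrite nderivnMXaddC mulrDr !raddfD/= nderivnC addr0.
rewrite [_ * c%:P]mulrC mul_polyC linearZ/= -mul_polyC.
have -> : ((p \Po ('X + c%:P)) * 'X)^`N(n.+1) =
  (p \Po ('X + c%:P))^`N(n) + (p \Po ('X + c%:P))^`N(n.+1) * 'X.
  by have := nderivnMXaddC n (p \Po ('X + c%:P)) 0; rewrite addr0.
rewrite comp_polyM comp_polyX !IH; ring.
Qed.

(** Leibniz' rule: each term keeps at least m - n of the m factors X. *)
Lemma dvdXn_nderivn p m n : (exists r, p = r * 'X^m) ->
  exists r, p^`N(n) = r * 'X^(m - n).
Proof.
move=> [r ->]; rewrite nderivnM.
exists (\sum_(j < n.+1) r^`N(j) *
  ('X^(m - (n - j) - (m - n)) *+ 'C(m, n - j))).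
rewrite mulr_suml; apply: eq_bigr => j _; rewrite nderivnXn -mulrA; congr (_ * _).
by rewrite mulrnAl -exprD subnK//; lia.
Qed.

End HasseDerivatives.

(** * Hasse derivatives of a root of a quadratic equation *)

Section QuadraticSequences.
Context {S : comNzRingType}.

Lemma reduce_quadratic (p q : S) (e : {poly S}) : exists u s t,
  e = u * ('X^2 + q%:P * 'X - p%:P) + (s%:P + t%:P * 'X).
Proof.
elim/poly_ind: e => [|e c [u [s [t ->]]]].
  by exists 0, 0, 0; rewrite !mul0r !addr0.
exists (u * 'X + t%:P), (t * p + c), (s - t * q).
rewrite rmorphD rmorphB !rmorphM /=; ring.
Qed.

(** The m-th coefficient of y(T)^2 + q(T) y(T) = p(T), where p and q have their
   coefficients in S and y in the S-algebra B. *)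
Definition solves (B : comNzRingType) (phi : {rmorphism S -> B})
    (p q : nat -> S) (y : nat -> B) m :=
  \sum_(j < m.+1) y j * y (m - j)%N + \sum_(j < m.+1) phi (q j) * y (m - j)%N =
  phi (p m).

(** Isolating y_(n+1) in the equation of index n + 1 and multiplying by w^(2n)
   leaves only products of terms w^(2j+1) y_(j+1), which are known by induction.
   The polynomial e does not depend on B, phi and y: this is what makes the
   formula specialize. *)
Lemma solution_numerator_poly (p q : nat -> S) n : exists e : {poly S},
  forall (B : comNzRingType) (phi : {rmorphism S -> B}) (y : nat -> B),
  (forall m, (m <= n.+1)%N -> solves phi p q y m) ->
  (2 * y 0 + phi (q 0)) ^+ (2 * n).+1 * y n.+1 = (map_poly phi e).[y 0].
Proof.
elim/ltn_ind: n => n IH.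
have /boolp.choice[e He] : forall m, exists e : {poly S}, (m < n)%N ->
  forall (B : comNzRingType) (phi : {rmorphism S -> B}) (y : nat -> B),
  (forall j, (j <= m.+1)%N -> solves phi p q y j) ->
  (2 * y 0 + phi (q 0)) ^+ (2 * m).+1 * y m.+1 = (map_poly phi e).[y 0].
  move=> m; have [lt_mn|_] := ltnP m n; last by exists 0.
  by have [e He] := IH m lt_mn; exists e.
pose w : {poly S} := 2%:R * 'X + (q 0)%:P.
exists (w ^+ (2 * n) * ((p n.+1)%:P - (q n.+1)%:P * 'X)
  - \sum_(j < n) (e j + (q j.+1)%:P * w ^+ (2 * j).+1) * e (n - j.+1)%N).
move=> B phi y Hy.
have ew : (map_poly phi w).[y 0] = 2 * y 0 + phi (q 0).
  rewrite /w rmorphD rmorphM /= map_polyX map_polyC/= rmorphMn rmorph1/=.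
  by rewrite !hornerE.
have He' j : (j < n)%N ->
  (2 * y 0 + phi (q 0)) ^+ (2 * j).+1 * y j.+1 = (map_poly phi (e j)).[y 0].
  by move=> lt_jn; apply: He => // m le_m; apply: Hy; lia.
set z := 2 * y 0 + phi (q 0) in ew He' *.
have E : z * y n.+1 = phi (p n.+1) - phi (q n.+1) * y 0 -
    \sum_(j < n) (y j.+1 + phi (q j.+1)) * y (n - j)%N.
  have := Hy n.+1 (leqnn _); rewrite /solves => <-.
  rewrite [X in _ = X + _ - _ - _]big_ord_recl/=.
  rewrite [X in _ = _ + X + _ - _ - _]big_ord_recr/=.
  rewrite [X in _ = _ + X - _ - _]big_ord_recl/=.
  rewrite [X in _ = _ + (_ + X) - _ - _]big_ord_recr/=.
  rewrite /bump/= !add1n !subn0 subnn.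
  under [X in _ = _ - X]eq_bigr do rewrite mulrDl.
  rewrite big_split/= /z; ring.
rewrite rmorphB rmorphM rmorphXn rmorphB rmorphM /= !map_polyC map_polyX/=.
rewrite rmorph_sum/= hornerD hornerN hornerM horner_exp ew hornerD hornerN.
rewrite hornerM !hornerC hornerX horner_sum exprSr -mulrA E mulrBr mulr_sumr.
congr (_ - _); apply: eq_bigr => j _; have lt_jn := ltn_ord j.
rewrite rmorphM rmorphD rmorphM rmorphXn/= map_polyC/= hornerM hornerD hornerM.
rewrite horner_exp ew hornerC -!He'//; last by lia.
have -> : (n - j = (n - j.+1).+1)%N by lia.
have -> : z ^+ (2 * n) = z ^+ (2 * j).+1 * z ^+ (2 * (n - j.+1)).+1.
  by rewrite -exprD; congr (_ ^+ _); lia.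
ring.
Qed.

(** Reduction modulo the equation of index 0 satisfied by y_0. *)
Lemma solution_numerators (p q : nat -> S) : exists s t : nat -> S,
  forall n, (0 < n)%N ->
  forall (B : comNzRingType) (phi : {rmorphism S -> B}) (y : nat -> B),
  (forall m, (m <= n)%N -> solves phi p q y m) ->
  (2 * y 0 + phi (q 0)) ^+ (2 * n - 1) * y n = phi (s n) + phi (t n) * y 0.
Proof.
have /boolp.choice[st Hst] : forall n, exists st : S * S, (0 < n)%N ->
  forall (B : comNzRingType) (phi : {rmorphism S -> B}) (y : nat -> B),
  (forall m, (m <= n)%N -> solves phi p q y m) ->
  (2 * y 0 + phi (q 0)) ^+ (2 * n - 1) * y n = phi st.1 + phi st.2 * y 0.
  case=> [|n]; first by exists 0.
  have [e He] := solution_numerator_poly p q n.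
  have [u [s [t Ee]]] := reduce_quadratic (p 0) (q 0) e.
  exists (s, t) => _ B phi y Hy.
  have -> : (2 * n.+1 - 1 = (2 * n).+1)%N by lia.
  rewrite He// Ee !(rmorphD, rmorphM, rmorphXn)/= rmorphN/=.
  rewrite !map_polyC map_polyX/=.
  rewrite !(hornerD, hornerM, hornerN, hornerC, hornerX, horner_exp).
  have := Hy 0 isT; rewrite /solves !big_ord1 subn0 => <-.
  by rewrite -expr2 subrr mulr0 add0r.
by exists (fun n => (st n).1), (fun n => (st n).2).
Qed.

End QuadraticSequences.

(** * The function field as a quadratic extension *)

Section LinearPolynomials.
Context {A : nzRingType}.

Lemma poly_linear_eq0 (a b : A) : a%:P + b%:P * 'X = 0 -> a = 0 /\ b = 0.
Proof.
move=> /polyP h; split; [have := h 0 | have := h 1];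
  by rewrite coef0 coefD coefMX !coefC/= ?addr0 ?add0r.
Qed.

Lemma poly_linearE (p : {poly A}) : (size p < 3)%N ->
  p = (p`_0)%:P + (p`_1)%:P * 'X.
Proof.
move=> sp; apply/polyP => i; rewrite coefD coefMX !coefC.
case: i => [|[|i]] /=; rewrite ?addr0 ?add0r//.
by rewrite nth_default// (leq_trans (n := 2))// -ltnS.
Qed.

End LinearPolynomials.

Lemma rmorph_quadratic (A B : comNzRingType) (h : {rmorphism A -> B}) (x c d : A) :
  h (x ^+ 2 + c * x - d) = h x ^+ 2 + h c * h x - h d.
Proof. by rewrite rmorphB rmorphD rmorphXn rmorphM. Qed.

Section FunctionFieldBasis.
Context {R : idomainType} {g : nat} (E : weierstrass R g).
Local Notation K := (funfield E).
Local Notation F := {fraction {poly R}}.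

(** Same underlying term as fpoly, on the whole field of rational functions. *)
Definition ffrac : F -> K := qfpoly_const (weq_irreducible E).

Fact ffrac_is_zmod_morphism : zmod_morphism ffrac.
Proof. exact: qpolyC_is_zmod_morphism. Qed.

Fact ffrac_is_monoid_morphism : monoid_morphism ffrac.
Proof. exact: (qpolyC_is_monoid_morphism (weq E)). Qed.

HB.instance Definition _ :=
  GRing.isZmodMorphism.Build F K ffrac ffrac_is_zmod_morphism.
HB.instance Definition _ :=
  GRing.isMonoidMorphism.Build F K ffrac ffrac_is_monoid_morphism.

Lemma fpolyE p : fpoly E p = ffrac (FracField.tofrac p).
Proof. by []. Qed.

Lemma mk_monic_weq : mk_monic (weq E) = weq E.
Proof. by rewrite /mk_monic size_weq weq_monic. Qed.

Lemma val_ffrac_combination a b :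
  (ffrac a + ffrac b * fy E : {poly %/ weq E}) = a%:P + b%:P * 'X :> {poly F}.
Proof.
have fyE : (fy E : {poly %/ weq E}) = 'X :> {poly F}.
  by rewrite [LHS](qpolyXE (h := weq E)) ?size_weq ?weq_monic.
rewrite [LHS]poly_of_qpolyD; congr (_ + _).
transitivity (Pdiv.CommonRing.rmodp (b%:P * 'X) (mk_monic (weq E))).
  by rewrite [LHS]poly_of_qpolyM fyE.
rewrite mk_monic_weq Pdiv.CommonRing.rmodp_small// size_weq mul_polyC.
by rewrite (leq_ltn_trans (size_scale_leq _ _))// size_polyX.
Qed.

Lemma ffrac_basis_eq0 a b : ffrac a + ffrac b * fy E = 0 -> a = 0 /\ b = 0.
Proof.
move=> ab0; apply: poly_linear_eq0.
by rewrite -val_ffrac_combination ab0.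
Qed.

Lemma ffrac_basis_span (u : K) : exists a b, u = ffrac a + ffrac b * fy E.
Proof.
exists (u : {poly %/ weq E})`_0, (u : {poly %/ weq E})`_1.
apply: val_inj; apply: eq_trans (esym (val_ffrac_combination _ _)).
apply: poly_linearE; apply: leq_trans (size_mk_monic u) _.
by rewrite mk_monic_weq size_weq.
Qed.

Lemma weierstrass_eq : fy E ^+ 2 + fpoly E (wQ E) * fy E = fpoly E (wP E).
Proof.
pose h : {rmorphism {poly F} -> {poly %/ weq E}} := in_qpoly (weq E).
have E0 : h (weq E) = 0.
  apply: val_inj; rewrite /= mk_monic_weq.
  by rewrite Pdiv.RingMonic.rmodpp ?weq_monic.
have EC c : h c%:P = ffrac c.
  apply: val_inj; apply: (in_qpoly_small (p := c%:P)).
  rewrite mk_monic_weq size_weq.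
  by rewrite (leq_ltn_trans (size_polyC_leq1 _)).
have E1 := eq_trans (esym (rmorph_quadratic h 'X
  (wfrac (wQ E))%:P (wfrac (wP E))%:P)) E0.
rewrite !fpolyE -(EC (wfrac (wQ E))) -(EC (wfrac (wP E))).
exact: (subr0_eq E1).
Qed.

Lemma fpoly_eq0 p : (fpoly E p == 0) = (p == 0).
Proof. by rewrite fpolyE fmorph_eq0 tofrac_eq0. Qed.

Lemma fpoly_basis_eq0 a b : fpoly E a + fpoly E b * fy E = 0 -> a = 0 /\ b = 0.
Proof.
rewrite !fpolyE => /ffrac_basis_eq0 [/eqP + /eqP].
by rewrite !tofrac_eq0 => /eqP -> /eqP ->.
Qed.

End FunctionFieldBasis.

(** * Derivations of the function field *)

Section Derivation.
Context {R : idomainType} {F : fieldType} (i : {rmorphism {poly R} -> F}).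
Hypothesis i_neq0 : forall p, p != 0 -> i p != 0.
Hypothesis fraction_span : forall u, exists a b, b != 0 /\ u = i a / i b.

(** The quotient rule does not depend on the chosen numerator and denominator. *)
Lemma fraction_derivation : exists d : F -> F,
  [/\ forall u v, d (u + v) = d u + d v,
      forall u v, d (u * v) = d u * v + u * d v
    & forall p : {poly R}, d (i p) = i p^`()].
Proof.
have /boolp.choice[f Hf] : forall u : F, exists ab : {poly R} * {poly R},
    ab.2 != 0 /\ u = i ab.1 / i ab.2.
  by move=> u; have [a [b [b0 ->]]] := fraction_span u; exists (a, b).
pose d u : F := i ((f u).1^`() * (f u).2 - (f u).1 * (f u).2^`()) / i (f u).2 ^+ 2.
have dE a b : b != 0 -> d (i a / i b) = i (a^`() * b - a * b^`()) / i b ^+ 2.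
  move=> b_neq0; rewrite /d; case: (f _) (Hf (i a / i b)) => p q /= [q_neq0].
  have bn := i_neq0 b_neq0; have qn := i_neq0 q_neq0.
  move/eqP; rewrite eqr_div// => /eqP; rewrite -!rmorphM => Ei.
  have Eab : a * q = p * b.
    apply/eqP; rewrite -subr_eq0; apply: contraT => /i_neq0.
    by rewrite rmorphB Ei subrr eqxx.
  apply/eqP; rewrite eqr_div ?expf_neq0// -!rmorphXn -!rmorphM.
  apply/eqP; congr (i _).
  have := congr1 (fun p => p^`()) Eab; rewrite !derivM => Ed.
  apply/eqP; rewrite -subr_eq0.
  (* the difference is a combination of a q = p b and of its derivative *)
  rewrite (_ : _ - _ = b * q * ((p^`() * b + p * b^`()) - (a^`() * q + a * q^`()))
    + (b^`() * q + b * q^`()) * (a * q - p * b)); last by ring.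
  by rewrite Eab Ed !subrr !mulr0 addr0.
exists d; split.
- move=> u v; have [a [b [b0 ->]]] := fraction_span u.
  have [p [q [q0 ->]]] := fraction_span v.
  rewrite (_ : _ + _ = i (a * q + p * b) / i (b * q)); last first.
    by rewrite rmorphD !rmorphM; field; rewrite !i_neq0.
  rewrite !dE ?mulf_neq0// !(derivM, derivD) !(rmorphB, rmorphD, rmorphM)/=.
  by field; rewrite !i_neq0.
- move=> u v; have [a [b [b0 ->]]] := fraction_span u.
  have [p [q [q0 ->]]] := fraction_span v.
  rewrite (_ : _ / _ * _ = i (a * p) / i (b * q)); last first.
    by rewrite !rmorphM; field; rewrite !i_neq0.
  rewrite !dE ?mulf_neq0// !(derivM, derivD) !(rmorphB, rmorphD, rmorphM)/=.
  by field; rewrite !i_neq0.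
- move=> p; have := dE p 1 (oner_neq0 _).
  by rewrite rmorph1 !divr1 derivC mulr0 mulr1 subr0 expr1n divr1.
Qed.

(** K is a quadratic extension F(y) of the field F of rational functions, with y a
   root of Y^2 + Q Y - P. *)
Context {K : fieldType} (h : {rmorphism F -> K}) (y : K) (P Q : {poly R}).
Hypothesis y_eq : y ^+ 2 + h (i Q) * y = h (i P).
Hypothesis basis_eq0 : forall a b, h a + h b * y = 0 -> a = 0 /\ b = 0.
Hypothesis basis_span : forall u, exists a b, u = h a + h b * y.

Lemma quadratic_fraction (u : K) : exists a b c : {poly R}, c != 0 /\
  u * h (i c) = h (i a) + h (i b) * y.
Proof.
have [a [b ->]] := basis_span u.
have [a1 [a2 [a2_neq0 ->]]] := fraction_span a.
have [b1 [b2 [b2_neq0 ->]]] := fraction_span b.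
exists (a1 * b2), (b1 * a2), (a2 * b2); split; first by rewrite mulf_neq0.
have a2n : h (i a2) != 0 by rewrite fmorph_eq0 i_neq0.
have b2n : h (i b2) != 0 by rewrite fmorph_eq0 i_neq0.
rewrite !fmorph_div !rmorphM/=.
by field; rewrite ?a2n ?b2n.
Qed.

(** Differentiating the equation forces y' = (P' - Q' y) / (2y + Q); the extension
   defined by this value satisfies Leibniz' rule on the basis (1, y). *)
Lemma quadratic_derivation : 2%:R * y + h (i Q) != 0 ->
  exists D : K -> K,
  [/\ forall u v, D (u + v) = D u + D v,
      forall u v, D (u * v) = D u * v + u * D v
    & forall p : {poly R}, D (h (i p)) = h (i p^`())].
Proof.
move=> w_neq0; have [d [dD dM dp]] := fraction_derivation.
have /boolp.choice[f Hf] : forall u : K, exists ab : F * F,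
    u = h ab.1 + h ab.2 * y.
  by move=> u; have [a [b ->]] := basis_span u; exists (a, b).
pose y1 := (h (i P^`()) - h (i Q^`()) * y) / (2%:R * y + h (i Q)).
pose D u := h (d (f u).1) + h (d (f u).2) * y + h (f u).2 * y1.
have DE a b : D (h a + h b * y) = h (d a) + h (d b) * y + h b * y1.
  rewrite /D; case: (f _) (Hf (h a + h b * y)) => p q /=.
  move/eqP; rewrite -subr_eq0 opprD addrACA -mulrBl -!rmorphB /=.
  move=> /eqP /basis_eq0 [/eqP + /eqP].
  by rewrite !subr_eq0 => /eqP -> /eqP ->.
have dB a b : d (a - b) = d a - d b.
  by apply: (addIr (d b)); rewrite -dD !subrK.
have d0 : d 0 = 0 by apply: (addIr (d 0)); rewrite -dD !add0r.
exists D; split.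
- move=> u v; have [a [b ->]] := basis_span u.
  have [p [q ->]] := basis_span v.
  rewrite addrACA -mulrDl -!rmorphD /= !DE !dD !rmorphD /=; ring.
- move=> u v; have [a [b ->]] := basis_span u.
  have [p [q ->]] := basis_span v.
  have Ey : y ^+ 2 = h (i P) - h (i Q) * y by rewrite -y_eq addrK.
  rewrite (_ : (_ + _) * _ = h (a * p + b * q * i P) +
    h (a * q + b * p - b * q * i Q) * y); last first.
    by rewrite !(rmorphB, rmorphD, rmorphM)/=; ring: Ey.
  have Ey1 : h (i P^`()) = (2%:R * y + h (i Q)) * y1 + h (i Q^`()) * y.
    by rewrite /y1 [_ * (_ / _)]mulrC divfK// subrK.
  rewrite !DE !(dB, dD, dM, dp) !(rmorphB, rmorphD, rmorphM)/=.
  by ring: Ey1 Ey.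
- move=> p; have := DE (i p) 0.
  by rewrite d0 dp !rmorph0 !mul0r !addr0.
Qed.

End Derivation.

(** * Coefficients of highest degree *)

Section TopCoefficient.
Context {R : comNzRingType}.
Implicit Types (p q : {poly R}) (c : R) (d : nat).

(** A bound on the degree with a possibly zero coefficient c in degree d, so that
   the property is stable under sums and products without side conditions. *)
Definition has_top d p c := (size p <= d.+1)%N /\ p`_d = c.

Lemma has_top0 d : has_top d 0 0.
Proof. by split; rewrite ?size_poly0 ?coef0. Qed.

Lemma has_topD d p q a b : has_top d p a -> has_top d q b ->
  has_top d (p + q) (a + b).
Proof.
move=> [sp <-] [sq <-]; split; last by rewrite coefD.
by rewrite (leq_trans (size_polyD _ _))// geq_max sp.
Qed.

Lemma has_topM d e p q a b : has_top d p a -> has_top e q b ->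
  has_top (d + e) (p * q) (a * b).
Proof.
move=> [sp <-] [sq <-]; split.
  by rewrite (leq_trans (size_polyMleq _ _))//; lia.
rewrite coefM (bigD1 (inord d)) //= inordK ?leq_addr// ?ltnS// addKn.
  rewrite big1 ?addr0// => i /eqP /val_eqP /=; rewrite inordK ?ltnS ?leq_addr//.
  move=> i_neq_d; have [lt_id|lt_di|eq_id] := ltngtP (i : nat) d.
  - by rewrite [q`__]nth_default ?mulr0// (leq_trans sq)//; lia.
  - by rewrite nth_default ?mul0r// (leq_trans sp)//; lia.
  - by rewrite eq_id eqxx in i_neq_d.
Qed.

Lemma has_topC c : has_top 0 c%:P c.
Proof. by split; rewrite ?size_polyC_leq1 ?coefC. Qed.

Lemma has_topZ d p a c : has_top d p a -> has_top d (c%:P * p) (c * a).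
Proof. exact: has_topM (has_topC c). Qed.

Lemma has_topX d p c : has_top d.+1 ('X * p) c -> has_top d p c.
Proof.
move=> [sp cp]; split; last by rewrite -cp coefXM.
have [->|p0] := eqVneq p 0; first by rewrite size_poly0.
by move: sp; rewrite mulrC size_mulX.
Qed.

(** Multiplication by X keeps the degrees equal, hence avoids the case d = 0. *)
Lemma has_top_XM_deriv d p c : has_top d p c -> has_top d ('X * p^`()) (c *+ d).
Proof.
move=> [sp <-]; split; last first.
  by rewrite coefXM; case: d sp => //= d _; rewrite coef_deriv.
rewrite (leq_trans (size_polyMleq _ _))// size_polyX.
have := lt_size_deriv; have [->|p0] := eqVneq p 0.
  by rewrite deriv0 size_poly0.
by move=> /(_ _ _ p0); lia.
Qed.

Lemma has_top_sum (I : finType) (P : pred I) d (f : I -> {poly R}) (c : I -> R) :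
  (forall i, has_top d (f i) (c i)) ->
  has_top d (\sum_(i | P i) f i) (\sum_(i | P i) c i).
Proof.
move=> h; apply: (big_ind2 (has_top d)) => [|p a q b|i _]; first exact: has_top0.
  exact: has_topD.
exact: h.
Qed.

Lemma has_top_prod (I : finType) (d : I -> nat) (f : I -> {poly R}) (c : I -> R) :
  (forall i, has_top (d i) (f i) (c i)) ->
  has_top (\sum_i d i) (\prod_i f i) (\prod_i c i).
Proof.
move=> h; elim: (index_enum I) => [|i r IH].
  by rewrite !big_nil; apply: has_topC.
by rewrite !big_cons; apply: has_topM.
Qed.

Lemma has_top_det m (d : 'I_m -> 'I_m -> nat) D (A : 'M[{poly R}]_m) (c : 'M[R]_m) :
  (forall i j, has_top (d i j) (A i j) (c i j)) ->
  (forall s : 'S_m, \sum_i d i (s i) = D)%N ->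
  has_top D (\det A) (\det c).
Proof.
move=> h hd; apply: has_top_sum => s.
have -> : (-1) ^+ s = ((-1) ^+ s)%:P :> {poly R} by rewrite rmorphXn rmorphN1.
apply: has_topZ; rewrite -(hd s); apply: has_top_prod => i; exact: h.
Qed.

End TopCoefficient.

(** * Divided powers of a derivation in characteristic 0 *)

Section DividedDerivation.
Context {K : fieldType} (D : K -> K).
Hypothesis DD : forall u v, D (u + v) = D u + D v.
Hypothesis DM : forall u v, D (u * v) = D u * v + u * D v.
Hypothesis K0 : forall n, n.+1%:R != 0 :> K.

Lemma derivation1 : D 1 = 0.
Proof. by apply: (addIr (D 1)); rewrite add0r -{3}[1]mulr1 DM mulr1 mul1r. Qed.

Lemma derivation0 : D 0 = 0.
Proof. by apply: (addIr (D 0)); rewrite -DD !add0r. Qed.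

Lemma derivation_nat n : D n%:R = 0.
Proof.
by elim: n => [|n IH]; rewrite ?derivation0// -natr1 DD IH derivation1 addr0.
Qed.

Lemma derivationMn n u : D (n%:R * u) = n%:R * D u.
Proof. by rewrite DM derivation_nat mul0r add0r. Qed.

(** Multiplied by u to avoid the exponent n - 1. *)
Lemma derivationXM n u : D (u ^+ n) * u = n%:R * u ^+ n * D u.
Proof.
elim: n => [|n IH]; first by rewrite expr0 derivation1 !mul0r.
rewrite exprS DM mulrDl -[u * _ * u]mulrA IH -natr1; ring.
Qed.

Lemma derivation_sum m (f : 'I_m -> K) : D (\sum_j f j) = \sum_j D (f j).
Proof. exact: (big_morph D DD derivation0). Qed.

Definition divided n u := iter n D u / n`!%:R.

Lemma fact_neq0 n : n`!%:R != 0 :> K.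
Proof. by have := K0 (n`!).-1; rewrite prednK ?fact_gt0. Qed.

Lemma dividedS n u : n.+1%:R * divided n.+1 u = D (divided n u).
Proof.
have fn := fact_neq0 n; have n1 := K0 n.
apply: (mulfI fn); rewrite -derivationMn /divided [in RHS]mulrC divfK//=.
by rewrite factS natrM; field; rewrite fn addrC natr1.
Qed.

Lemma divided0 u : divided 0 u = u.
Proof. by rewrite /divided divr1. Qed.

Lemma dividedD n u v : divided n (u + v) = divided n u + divided n v.
Proof.
rewrite /divided -mulrDl; congr (_ / _).
by elim: n u v => //= n IH u v; rewrite IH DD.
Qed.

Lemma dividedM n u v :
  divided n (u * v) = \sum_(j < n.+1) divided j u * divided (n - j) v.
Proof.
elim: n => [|n IH]; first by rewrite big_ord1 !divided0.
apply: (mulfI (K0 n)); rewrite dividedS IH derivation_sum.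
under eq_bigr do rewrite DM -!dividedS.
rewrite big_split/= mulr_sumr.
rewrite (eq_bigr (fun j : 'I_n.+2 => j%:R * divided j u * divided (n.+1 - j) v
  + (n.+1 - j)%:R * divided j u * divided (n.+1 - j) v)); last first.
  move=> j _; rewrite -mulrDl -mulrDl -natrD subnKC ?mulrA//.
  by rewrite -ltnS ltn_ord.
rewrite big_split/=; congr (_ + _).
  rewrite [RHS]big_ord_recl !mul0r add0r; apply: eq_bigr => j _.
  by rewrite lift0 subSS.
rewrite [RHS]big_ord_recr/= subnn !mul0r addr0; apply: eq_bigr => j _.
rewrite subSn; first by ring.
by rewrite -ltnS ltn_ord.
Qed.

End DividedDerivation.

(** * Numerators of the Hasse derivatives of y *)

Section Numerators.
Context {R : idomainType} {K : fieldType} (f : {rmorphism {poly R} -> K}).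
Context (y : K) (P Q : {poly R}) (g : nat) (D : K -> K).
Hypothesis Q_size : (size Q <= g.+1)%N.
Hypothesis y_eq : y ^+ 2 + f Q * y = f P.
Hypothesis basis_eq0 : forall a b, f a + f b * y = 0 -> a = 0 /\ b = 0.
Hypothesis DD : forall u v, D (u + v) = D u + D v.
Hypothesis DM : forall u v, D (u * v) = D u * v + u * D v.
Hypothesis Df : forall p, D (f p) = f p^`().
Hypothesis K0 : forall n, n.+1%:R != 0 :> K.

Local Notation w := (2%:R * y + f Q).
Local Notation F := (4%:R * P + Q ^+ 2).
Local Notation P_ := (fun n => P^`N(n)).
Local Notation Q_ := (fun n => Q^`N(n)).

Lemma w_sqr : w ^+ 2 = f F.
Proof.
rewrite rmorphD rmorphM rmorphXn rmorph_nat -y_eq /=; ring.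
Qed.

Lemma iter_derivation_poly n p : iter n D (f p) = f p^`(n).
Proof. by elim: n => //= n ->; rewrite Df. Qed.

Lemma divided_poly n p : divided D n (f p) = f p^`N(n).
Proof.
rewrite /divided iter_derivation_poly nderivn_def rmorphMn /=.
by rewrite -[f _ *+ _]mulr_natr mulfK// fact_neq0.
Qed.

Lemma derivatives_solve n : solves f P_ Q_ (fun m => divided D m y) n.
Proof.
rewrite /solves -divided_poly -y_eq dividedD// expr2 !dividedM//.
by congr (_ + _); apply: eq_bigr => j _; rewrite divided_poly.
Qed.

(** 2^n n! F^n D_n(sqrt F) / sqrt F.  The recursion comes from the derivative of
   sqrt F * F^-n, which is (1/2 - n) F' / F times itself. *)
Fixpoint sqrt_numerator n : {poly R} :=
  if n is m.+1 then
    (1 - 2%:R * m%:R) * F^`() * sqrt_numerator m +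
    2%:R * F * (sqrt_numerator m)^`()
  else 1.

Lemma iter_derivation_w n :
  iter n D w * 2%:R ^+ n * f F ^+ n = w * f (sqrt_numerator n).
Proof.
have Dw : 2%:R * f F * D w = w * f F^`().
  rewrite -Df -w_sqr expr2 DM; ring.
elim: n => [|n IH]; first by rewrite !expr0 rmorph1 !mulr1.
have D2 : D (2%:R ^+ n) = 0 by rewrite -natrX derivation_nat.
have DF : f F * D (f F ^+ n) = n%:R * f F ^+ n * f F^`().
  by rewrite -Df mulrC derivationXM.
have E := congr1 D IH; rewrite !DM D2 Df mulr0 addr0 in E.
transitivity (2%:R * f F * (D (iter n D w) * 2%:R ^+ n * f F ^+ n)).
  by rewrite /= !exprS; ring.
rewrite (_ : _ * 2%:R ^+ n * _ =
  D w * f (sqrt_numerator n) + w * f (sqrt_numerator n)^`()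
  - iter n D w * 2%:R ^+ n * D (f F ^+ n)); last by rewrite -E addrK.
rewrite mulrBr mulrDr mulrA Dw (_ : _ * _ * (_ * D (f F ^+ n)) =
  2%:R * n%:R * (iter n D w * 2%:R ^+ n * f F ^+ n) * f F^`()); last first.
  rewrite -!mulrA; congr (_ * _); rewrite mulrC -!mulrA [D _ * _]mulrC DF; ring.
by rewrite IH [sqrt_numerator n.+1]/=; ring.
Qed.

(** Since D_n(Q) = 0 for n > g, 2 D_n(y) = D_n(w) lies in w R(x), and
   multiplication by w^(2n-1) brings it into R(x): the coordinate along y is 0. *)
Lemma numerator_unique n (s t : {poly R}) : (g < n)%N ->
  w ^+ (2 * n - 1) * divided D n y = f s + f t * y ->
  t = 0 /\ (2 ^ n.+1 * n`!)%:R * s = sqrt_numerator n.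
Proof.
move=> lt_gn E; have w_neq0 : w != 0.
  apply/eqP => w0; have /basis_eq0[_] : f Q + f 2%:R * y = 0.
    by rewrite rmorph_nat addrC.
  by move/(congr1 f)/eqP; rewrite rmorph_nat rmorph0 (negPf (K0 1)).
have fn := fact_neq0 K0 n.
have Ew : divided D n w = 2%:R * divided D n y.
  rewrite dividedD// divided_poly nderivn_poly0 ?(leq_trans Q_size)// rmorph0 addr0.
  by rewrite (_ : 2%:R * y = y + y) ?dividedD//; ring.
have EH : w * ((2 ^ n.+1 * n`!)%:R * (f s + f t * y)) = w * f (sqrt_numerator n).
  rewrite -iter_derivation_w -E -w_sqr.
  have -> : iter n D w = n`!%:R * divided D n w by rewrite [RHS]mulrC divfK.
  rewrite Ew natrM natrX exprS -exprM.
  rewrite (_ : w ^+ (2 * n) = w * w ^+ (2 * n - 1)); first by ring.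
  by rewrite -exprS; congr (_ ^+ _); lia.
have := mulfI w_neq0 EH; move/eqP; rewrite -subr_eq0.
rewrite (_ : _ - _ = f ((2 ^ n.+1 * n`!)%:R * s - sqrt_numerator n) +
  f ((2 ^ n.+1 * n`!)%:R * t) * y); last first.
  by rewrite rmorphB !rmorphM !rmorph_nat/=; ring.
move/eqP/basis_eq0 => [/eqP]; rewrite subr_eq0 => /eqP Es /eqP.
rewrite mulf_eq0 => /orP[|/eqP ->]; last by [].
move=> /eqP /(congr1 f) /eqP; rewrite rmorph_nat rmorph0 natrM natrX.
by rewrite mulf_eq0 expf_eq0 (negPf fn) (negPf (K0 1)) andbF.
Qed.

(** The natural formula of solution_numerators, applied in the function field, has
   t_n = 0; naturality then carries this to every other solution. *)
Lemma numerators_exist : exists s : nat -> {poly R}, forall n, (g < n)%N ->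
  (2 ^ n.+1 * n`!)%:R * s n = sqrt_numerator n /\
  forall (B : comNzRingType) (phi : {rmorphism {poly R} -> B}) (z : nat -> B),
    (forall m, (m <= n)%N -> solves phi P_ Q_ z m) ->
    (2 * z 0 + phi Q) ^+ (2 * n - 1) * z n = phi (s n).
Proof.
have [s [t st]] := solution_numerators P_ Q_.
exists s => n lt_gn; have n_gt0 : (0 < n)%N by apply: leq_ltn_trans lt_gn.
have := st n n_gt0 K f (fun m => divided D m y) (fun m _ => derivatives_solve m).
rewrite divided0 nderivn0 => /(numerator_unique lt_gn)[t0 ->]; split=> //.
move=> B phi z Hz; have := st n n_gt0 B phi z Hz.
by rewrite nderivn0 t0 rmorph0 mul0r addr0.
Qed.

End Numerators.

Lemma basis_numerator_unique (R : idomainType) (K : fieldType)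
    (f : {rmorphism {poly R} -> K}) (y u v : K) (a b c : {poly R}) :
  (forall a b, f a + f b * y = 0 -> a = 0 /\ b = 0) -> v != 0 ->
  u = (f a + f b * y) / v -> v * u = f c -> a = c.
Proof.
move=> basis v_neq0 ->; rewrite mulrC divfK// => /eqP.
rewrite -subr_eq0 addrAC -rmorphB => /eqP /basis[/eqP + _].
by rewrite subr_eq0 => /eqP.
Qed.

(** * The universal determinant *)

Section UniversalMatrix.
Context {R : idomainType} {K : fieldType} (f : {rmorphism {poly R} -> K}).
Context (y : K) (P Q : {poly R}) (g : nat) (D : K -> K).
Hypothesis y_eq : y ^+ 2 + f Q * y = f P.
Hypothesis DD : forall u v, D (u + v) = D u + D v.
Hypothesis DM : forall u v, D (u * v) = D u * v + u * D v.
Hypothesis Df : forall p, D (f p) = f p^`().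
Hypothesis K0 : forall n, n.+1%:R != 0 :> K.
Local Notation w := (2%:R * y + f Q).
Local Notation F := (4%:R * P + Q ^+ 2).
Context (s : nat -> {poly R}).
Hypothesis s_num : forall n, (g < n)%N ->
  w ^+ (2 * n - 1) * divided D n y = f (s n).

(** Leibniz' rule for x^i y, multiplied by w^(2n-1): the l-th term takes the factor
   w^(2l) = F^l to complete w^(2(n-l)-1). *)
Lemma shifted_numerator m i n : (i < m)%N -> (m + g <= n)%N ->
  w ^+ (2 * n - 1) * divided D n (f 'X ^+ i * y) =
  f (\sum_(l < m) 'C(i, l)%:R * 'X^(i - l) * F ^+ l * s (n - l)).
Proof.
move=> lt_im le_n; rewrite -rmorphXn dividedM// mulr_sumr.
rewrite rmorph_sum/= (big_ord_widen n.+1 (fun l =>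
  f ('C(i, l)%:R * 'X^(i - l) * F ^+ l * s (n - l)))); last by lia.
rewrite [RHS]big_mkcond; apply: eq_bigr => -[l /= lt_l] _.
rewrite divided_poly// nderivnXn; case: ltnP => [lt_lm|le_ml]; last first.
  by rewrite bin_small ?mulr0n ?rmorph0 ?mul0r ?mulr0//; lia.
rewrite (_ : w ^+ (2 * n - 1) = w ^+ 2 ^+ l * w ^+ (2 * (n - l) - 1)); last first.
  by rewrite -exprM -exprD; congr (_ ^+ _); lia.
rewrite (w_sqr y_eq) -['X^_ *+ _]mulr_natl !rmorphM !rmorphXn /= -s_num; last by lia.
ring.
Qed.

End UniversalMatrix.

Section TopOfNumerators.
Context {R : idomainType} (P Q : {poly R}) (g : nat).
Hypothesis P_top : has_top (2 * g + 1) P 1.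
Hypothesis Q_size : (size Q <= g.+1)%N.
Local Notation F := (4%:R * P + Q ^+ 2).

(** Q^2 has degree at most 2g, so only 4P contributes. *)
Lemma discriminant_top : has_top (2 * g + 1) F 4%:R.
Proof.
rewrite -[X in has_top _ _ X]addr0; apply: has_topD.
  by have := has_topZ 4%:R P_top; rewrite mulr1 polyC_natr.
have sQ : (size (Q ^+ 2)%R <= 2 * g + 1)%N.
  by rewrite expr2 (leq_trans (size_polyMleq _ _))//; lia.
by split; [apply: leqW | rewrite nth_default].
Qed.

(** The product is n! 2^n binom(g + 1/2, n): the coefficients are those of the
   square root of 4 x^(2g+1). *)
Lemma sqrt_numerator_top n :
  has_top (2 * g * n) (sqrt_numerator P Q n)
    (4%:R ^+ n * \prod_(j < n) ((2 * g + 1)%:R - 2%:R * j%:R)).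
Proof.
have tF := discriminant_top.
elim: n => [|n IH].
  by rewrite muln0 big_ord0 mulr1; apply: has_topC.
apply: has_topX.
rewrite (_ : (2 * g * n.+1).+1 = 2 * g + 1 + 2 * g * n)%N; last by lia.
rewrite (_ : 'X * _ = (1 - 2%:R * n%:R)%:P * ('X * F^`() * sqrt_numerator P Q n) +
   2%:R%:P * (F * ('X * (sqrt_numerator P Q n)^`()))); last first.
  rewrite rmorphB rmorphM !rmorph_nat rmorph1 /=; ring.
move: IH; set h := (X in has_top _ _ X) => IH.
rewrite (_ : 4%:R ^+ n.+1 * _ =
   (1 - 2%:R * n%:R) * (4%:R *+ (2 * g + 1) * h) +
   2%:R * (4%:R * (h *+ (2 * g * n)))); last first.
  rewrite big_ord_recr /= exprS.
  rewrite -[4%:R *+ _]mulr_natr -[h *+ _]mulr_natr /h natrD !natrM.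
  move: (\prod_(_ < _) _) => t; ring.
apply: has_topD; apply: has_topZ; apply: has_topM => //.
  exact: has_top_XM_deriv.
exact: has_top_XM_deriv.
Qed.

End TopOfNumerators.

Section UniversalCurve.
Context (g : nat).
Local Notation K := (funfield (univ g)).

Lemma Lambda_succ_neq0 n : n.+1%:R != 0 :> Lambda g.
Proof.
by rewrite -(rmorph_nat (@mpolyC _ int)) mpolyC_eq0 pnatr_eq0.
Qed.

Lemma funfield_succ_neq0 n : n.+1%:R != 0 :> K.
Proof.
rewrite -(rmorph_nat (fpoly (univ g))) fpoly_eq0 -polyC_natr polyC_eq0.
exact: Lambda_succ_neq0.
Qed.

Lemma univP_top : has_top (2 * g + 1) (univP g) 1.
Proof.
split; first by rewrite size_univP.
by have /monicP := univP_monic g; rewrite lead_coefE size_univP.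
Qed.

Lemma univ_w_neq0 : 2%:R * fy (univ g) + fpoly (univ g) (univQ g) != 0.
Proof.
apply/eqP => w0; have /fpoly_basis_eq0[_] :
    fpoly (univ g) (univQ g) + fpoly (univ g) 2%:R * fy (univ g) = 0.
  by rewrite rmorph_nat addrC.
move/eqP; rewrite -polyC_natr polyC_eq0; apply/negP; exact: Lambda_succ_neq0.
Qed.

Lemma univ_derivation : exists D : K -> K,
  [/\ forall u v, D (u + v) = D u + D v,
      forall u v, D (u * v) = D u * v + u * D v
    & forall p, D (fpoly (univ g) p) = fpoly (univ g) p^`()].
Proof.
apply: (quadratic_derivation _ _ (@weierstrass_eq _ _ (univ g))).
- by move=> p; rewrite tofrac_eq0.
- exact: fractionP.
- exact: ffrac_basis_eq0.
- exact: ffrac_basis_span.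
- exact: univ_w_neq0.
Qed.

Lemma D1_derivation : is_D1 (@D1 g).
Proof.
apply: xgetPex; have [D [DD DM Df]] := univ_derivation.
exists D; split=> // [c|]; first by rewrite /fconst /= Df derivC rmorph0.
by rewrite /fx Df derivX rmorph1.
Qed.

Lemma D1_poly p : D1 (fpoly (univ g) p) = fpoly (univ g) p^`().
Proof.
have [DD DM Dc Dx] := D1_derivation.
elim/poly_ind: p => [|p c IH].
  by rewrite deriv0 rmorph0; apply: derivation0.
rewrite derivD derivM derivX derivC addr0 mulr1 !rmorphD !rmorphM.
by rewrite DD DM IH Dx Dc addr0 mulr1.
Qed.

Local Notation f := (fpoly (univ g)).
Local Notation y := (fy (univ g)).

(** The pair (s, t) defining s_ is unique because (1, y) is a basis. *)
Lemma s_of_numerator i n (a : {poly Lambda g}) :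
  (2%:R * y + f (univQ g)) ^+ (2 * n - 1) * divided (@D1 g) n (f 'X ^+ i * y) =
    f a ->
  s_ g i n = a.
Proof.
move=> E; have w_neq0 := expf_neq0 (2 * n - 1) univ_w_neq0.
have ex_st : is_st i n (a, 0).
  rewrite /is_st /= rmorph0 mul0r addr0 -E; apply: (canRL (mulfK w_neq0)).
  exact: mulrC.
have := xgetPex 0 (ex_intro (is_st (g := g) i n) _ ex_st).
move=> Est; apply: (basis_numerator_unique (@fpoly_basis_eq0 _ _ _) w_neq0 Est E).
Qed.

Lemma univF_neq0 : univF g != 0.
Proof.
have [_ /(congr1 (fun c => c != 0))] := discriminant_top univP_top (size_univQ g).
rewrite Lambda_succ_neq0 => F_top; apply: contraTneq F_top => F0.
by rewrite -/(univF g) F0 coef0 eqxx.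
Qed.

Lemma mu_g_lt_nu N : (2 * g + 1 <= N)%N -> (mu g N + g < nu N)%N.
Proof. by rewrite /mu /nu => ?; lia. Qed.

(** The matrix of Gamma is L times the Toeplitz matrix of the numerators, with L
   lower triangular of diagonal entries F^i; the exponents i add up to
   mu (mu + 1) / 2. *)
Lemma universal_numerators : exists s : nat -> {poly Lambda g},
  [/\ forall n, (g < n)%N ->
        (2 ^ n.+1 * n`!)%:R * s n = sqrt_numerator (univP g) (univQ g) n,
      forall n, (g < n)%N ->
        forall (B : comNzRingType) (phi : {rmorphism {poly Lambda g} -> B})
          (z : nat -> B),
        (forall m, (m <= n)%N ->
           solves phi (fun j => (univP g)^`N(j)) (fun j => (univQ g)^`N(j)) z m) ->
        (2%:R * z 0 + phi (univQ g)) ^+ (2 * n - 1) * z n = phi (s n)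
    & forall N, (2 * g + 1 <= N)%N -> Delta g N =
        \det (\matrix_(i < (mu g N).+1, j < (mu g N).+1) s (nu N + j - i)%N)].
Proof.
have [DD DM _ _] := D1_derivation.
have [s s_spec] := numerators_exist (size_univQ g) (weierstrass_eq (univ g))
  (@fpoly_basis_eq0 _ _ (univ g)) DD DM D1_poly funfield_succ_neq0.
exists s; split=> [n /s_spec[]// | n /s_spec[]// | N le_N].
have s_num n : (g < n)%N ->
    (2%:R * y + f (univQ g)) ^+ (2 * n - 1) * divided (@D1 g) n y = f (s n).
  move=> /s_spec[_ /(_ _ f (fun m => divided (@D1 g) m y))].
  rewrite divided0; apply => m _.
  exact: (derivatives_solve (weierstrass_eq (univ g)) DD DM D1_poly
    funfield_succ_neq0).
have lt_mu_nu := mu_g_lt_nu le_N.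
set T := \matrix_(i, j) _; set m := (mu g N).+1 in T *.
pose L : 'M[{poly Lambda g}]_m := \matrix_(i, l)
  ('C(i, l)%:R * 'X^(i - l) * univF g ^+ l).
have GammaE : Gamma g N = \det (L *m T).
  congr (\det _); apply/matrixP => i j; rewrite !mxE.
  under eq_bigr do rewrite !mxE.
  apply: s_of_numerator; apply: (shifted_numerator (weierstrass_eq (univ g)) DD DM
    D1_poly funfield_succ_neq0 s_num); first exact: ltn_ord.
  by rewrite /m; lia.
have detL : \det L = univF g ^+ (mu g N * (mu g N).+1 %/ 2).
  rewrite det_trig; last first.
    by apply/is_trig_mxP => i j lt_ij; rewrite mxE bin_small ?mul0r.
  rewrite (eq_bigr (fun i : 'I_m => univF g ^+ i)); last first.
    by move=> i _; rewrite mxE binn subnn expr0 !mul1r.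
  rewrite -expr_sum -(big_mkord xpredT id) -[X in \sum_(0 <= _ < X) _]/m.
  by rewrite bin2_sum bin2 mulnC /m /= divn2.
have DeltaE : Gamma g N = \det T * univF g ^+ (mu g N * (mu g N).+1 %/ 2).
  by rewrite GammaE det_mulmx detL mulrC.
have := xgetPex 0 (ex_intro (fun d => Gamma g N =
  d * univF g ^+ (mu g N * (mu g N).+1 %/ 2)) _ DeltaE).
rewrite -/(Delta g N) [in X in X -> _]DeltaE => /mulIf E.
by apply/esym/E; rewrite expf_neq0 ?univF_neq0.
Qed.

End UniversalCurve.

(** * Degree of the universal determinant *)

Section LeadingDeterminant.
Context {L : fieldType} (g N : nat) (c : nat -> L).
Hypothesis N_ge : (2 * g + 1 <= N)%N.
Hypothesis N_ge3 : (3 <= N)%N.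
Hypothesis nz : forall j, (0 < j <= N)%N -> j%:R != 0 :> L.
Hypothesis cE : forall n, (g < n)%N ->
  (2 * n`!)%:R * c n = 2%:R ^+ n * \prod_(j < n) ((2 * g + 1)%:R - 2%:R * j%:R).

Local Notation a := ((2 * g + 1)%:R / 2%:R : L).

Lemma two_neq0 : 2%:R != 0 :> L.
Proof. by apply: nz; rewrite (leq_trans _ N_ge3). Qed.

(** Solving the hypothesis on c for c n, with g + 1/2 = a. *)
Lemma leading_gbin n : (g < n)%N -> (n <= N)%N ->
  c n = 2%:R^-1 * 4%:R ^+ n * gbin a n.
Proof.
move=> lt_gn le_nN; have t0 := two_neq0.
have fn : n`!%:R != 0 :> L by apply: fact_neq0_le => m ?; apply: nz; lia.
have Efall : 4%:R ^+ n * falling a n =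
    2%:R ^+ n * \prod_(j < n) ((2 * g + 1)%:R - 2%:R * j%:R).
  rewrite (natrM _ 2 2) exprMn -mulrA; congr (_ * _).
  have -> : 2%:R ^+ n = \prod_(j < n) 2%:R :> L by rewrite prodr_const card_ord.
  rewrite -big_split /=; apply: eq_bigr => j _.
  by rewrite mulrBr mulrC divfK.
have nz2 : (2 * n`!)%:R != 0 :> L by rewrite natrM mulf_neq0.
apply: (mulfI nz2); rewrite cE// -Efall /gbin natrM.
by field; rewrite fn.
Qed.

(** Every factor is half of an odd integer between -N and N. *)
Lemma half_odd_falling_neq0 i : (i <= mu g N)%N -> falling (a + i%:R) (nu N) != 0.
Proof.
move=> le_i; have t0 := two_neq0; apply/prodf_neq0 => j _; have := ltn_ord j.
move: {j}(j : nat) => j lt_j.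
have -> : a + i%:R - j%:R = ((2 * g + 1 + 2 * i)%:R - (2 * j)%:R) / 2%:R.
  by field.
rewrite mulf_neq0 ?invr_eq0//; move: le_i lt_j; rewrite /mu /nu => le_i lt_j.
have [le_ji|lt_ij] := leqP (2 * j) (2 * g + 1 + 2 * i).
  by rewrite -natrB//; apply: nz; lia.
by rewrite -oppr_eq0 opprB -natrB; [apply: nz; lia | exact: ltnW].
Qed.

(** The factors 4^(nu+j-i) / 2 split into a diagonal matrix on each side. *)
Lemma leading_det_neq0 :
  \det (\matrix_(i < (mu g N).+1, j < (mu g N).+1) c (nu N + j - i)%N) != 0.
Proof.
have := mu_g_lt_nu N_ge => lt_mu_nu; have t0 := two_neq0.
pose m := (mu g N).+1.
pose r := \row_(i < m) (2%:R^-1 * 4%:R ^- i : L).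
pose q := \row_(j < m) (4%:R ^+ (nu N + j) : L).
have t4 : 4%:R != 0 :> L by rewrite (natrM _ 2 2) mulf_neq0.
have -> : \matrix_(i < (mu g N).+1, j < (mu g N).+1) c (nu N + j - i)%N =
  diag_mx r *m (\matrix_(i < m, j < m) gbin a (nu N + j - i)) *m diag_mx q.
  apply/matrixP => i j; rewrite mul_mx_diag mul_diag_mx !mxE.
  have := ltn_ord i; have := ltn_ord j => lt_j lt_i.
  rewrite leading_gbin; first last.
  - by move: lt_i lt_j; rewrite /mu /nu; lia.
  - by lia.
  have -> : 4%:R ^+ (nu N + j - i) = 4%:R ^+ (nu N + j) / 4%:R ^+ i :> L.
    apply: (canRL (mulfK _)); first by rewrite expf_neq0.
    by rewrite -exprD; congr (_ ^+ _); lia.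
  by move: (gbin _ _) (4%:R ^+ (_ + _)) (4%:R ^- _) => u v w; ring.
rewrite !det_mulmx !det_diag mulf_neq0 ?mulf_neq0//.
- by apply/prodf_neq0 => i _; rewrite mxE mulf_neq0 ?invr_eq0// expf_neq0.
- apply: det_gbin_toeplitz_neq0; first by lia.
  + by move=> j j_le; apply: nz; move: j_le; rewrite /mu /nu; lia.
  + exact: half_odd_falling_neq0.
- by apply/prodf_neq0 => i _; rewrite mxE expf_neq0.
Qed.

End LeadingDeterminant.

Section DegreeOfDelta.
Context (g : nat) (s : nat -> {poly Lambda g}).
Hypothesis s_sqrt : forall n, (g < n)%N ->
  (2 ^ n.+1 * n`!)%:R * s n = sqrt_numerator (univP g) (univQ g) n.

Let c n := (s n)`_(2 * g * n).

Lemma Lambda_nat_neq0 n : (0 < n)%N -> n%:R != 0 :> Lambda g.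
Proof. by case: n => // n _; apply: Lambda_succ_neq0. Qed.

Lemma numerator_top n : (g < n)%N -> has_top (2 * g * n) (s n) (c n).
Proof.
move=> lt_gn; split=> //.
have [+ _] := sqrt_numerator_top (univP_top g) (size_univQ g) n.
rewrite -s_sqrt// -polyC_natr size_Cmul// Lambda_nat_neq0//.
by rewrite muln_gt0 expn_gt0 fact_gt0.
Qed.

Lemma numerator_leading n : (g < n)%N ->
  (2 * n`!)%:R * c n = 2%:R ^+ n * \prod_(j < n) ((2 * g + 1)%:R - 2%:R * j%:R).
Proof.
move=> lt_gn.
have [_] := sqrt_numerator_top (univP_top g) (size_univQ g) n.
rewrite -s_sqrt// -polyC_natr coefCM -/(c n) => E.
have t0 : 2%:R ^+ n != 0 :> Lambda g by rewrite expf_neq0 ?Lambda_nat_neq0.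
apply: (mulfI t0); rewrite !mulrA -exprMn -natrM -E -natrX -natrM expnS.
by congr (_%:R * _); lia.
Qed.

Lemma deltaE N : (2 * g + 1 <= N)%N ->
  delta g N = (2 * g * ((mu g N).+1 * nu N))%N.
Proof.
move=> le_N; rewrite /delta /mu /nu; have := odd_double_half N.
case: (odd N) => /= E.
  have -> : (N + 1 = 2 * (N %/ 2).+1)%N by lia.
  have -> : (N - 2 * g + 1 = 2 * ((N - (2 * g + 1)) %/ 2).+1)%N by lia.
  by rewrite -[X in (X %/ 2)%N](_ : 2 * (2 * g * (((N - (2 * g + 1)) %/ 2).+1 *
    (N %/ 2).+1)) = _)%N ?mulKn//; lia.
have -> : (N + 2 = 2 * (N %/ 2).+1)%N by lia.
have -> : (N - 2 * g = 2 * ((N - (2 * g + 1)) %/ 2).+1)%N by lia.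
by rewrite -[X in (X %/ 2)%N](_ : 2 * (2 * g * (((N - (2 * g + 1)) %/ 2).+1 *
    (N %/ 2).+1)) = _)%N ?mulKn//; lia.
Qed.

(** In every term of the Leibniz expansion the shifts j - i cancel, leaving degree
   2 g nu (mu + 1). *)
Lemma toeplitz_top N : (2 * g + 1 <= N)%N ->
  has_top (delta g N)
    (\det (\matrix_(i < (mu g N).+1, j < (mu g N).+1) s (nu N + j - i)%N))
    (\det (\matrix_(i < (mu g N).+1, j < (mu g N).+1) c (nu N + j - i)%N)).
Proof.
move=> le_N; have lt_mu_nu := mu_g_lt_nu le_N.
apply: (has_top_det (d := fun i j => 2 * g * (nu N + j - i))%N) => [i j|t].
  by rewrite !mxE; apply: numerator_top; have := ltn_ord i; lia.
rewrite deltaE// -big_distrr /=; congr (_ * _)%N.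
apply/eqP; rewrite -(eqn_add2r (\sum_(i < (mu g N).+1) i)) -big_split /=.
rewrite (eq_bigr (fun i => nu N + t i)%N); last first.
  by move=> i _; have := ltn_ord i; lia.
rewrite big_split /= sum_nat_const card_ord eqn_add2l.
by rewrite [X in _ == X](reindex_inj (@perm_inj _ t)).
Qed.

(** In a field of values the n! are invertible, so the images of the leading
   coefficients are determined by their product with 2 n!. *)
Lemma toeplitz_leading_neq0 (L : fieldType) (phi : {rmorphism Lambda g -> L}) N :
  (1 <= g)%N -> (2 * g + 1 <= N)%N ->
  (forall j, (0 < j <= N)%N -> j%:R != 0 :> L) ->
  phi (\det (\matrix_(i < (mu g N).+1, j < (mu g N).+1) c (nu N + j - i)%N)) != 0.
Proof.
move=> g_gt0 le_N nz; rewrite -det_map_mx.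
rewrite (_ : map_mx _ _ = \matrix_(i, j) (phi \o c) (nu N + j - i)%N); last first.
  by apply/matrixP => i j; rewrite !mxE.
apply: leading_det_neq0 => //; first by lia.
move=> n lt_gn; have := congr1 phi (numerator_leading lt_gn).
rewrite !rmorphM rmorphXn rmorph_prod !rmorph_nat /= => ->.
by congr (_ * _); apply: eq_bigr => j _; rewrite rmorphB rmorphM !rmorph_nat.
Qed.

End DegreeOfDelta.

(** * Orders of vanishing in a local ring *)

Section Localization.
Context {S : comNzRingType} {K k : fieldType}.
Context (h : {rmorphism S -> K}) (e : {rmorphism S -> k}).
Hypothesis ker : forall p, h p = 0 -> e p = 0.
Implicit Types (f u : K) (p q : S).

(** The localization of the image of h at the prime h(ker e), as a subset of K. *)
Definition regular_at f := exists p q, e q != 0 /\ f = h p / h q.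
Definition vanishes_at f := exists p q, [/\ e q != 0, e p = 0 & f = h p / h q].
Definition unit_at u := [/\ u != 0, regular_at u & regular_at u^-1].
Definition uniformizes t := [/\ t != 0, vanishes_at t &
  forall f, vanishes_at f -> exists2 r, regular_at r & f = r * t].

Lemma h_neq0 q : e q != 0 -> h q != 0.
Proof. by apply: contraNneq => /ker ->. Qed.

Lemma regular_h p : regular_at (h p).
Proof. by exists p, 1; rewrite !rmorph1 divr1 oner_neq0. Qed.

Lemma regularD f1 f2 : regular_at f1 -> regular_at f2 -> regular_at (f1 + f2).
Proof.
move=> [p1 [q1 [n1 ->]]] [p2 [q2 [n2 ->]]].
exists (p1 * q2 + p2 * q1), (q1 * q2); rewrite rmorphM mulf_neq0//; split=> //.
by rewrite rmorphD !rmorphM; field; rewrite !h_neq0.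
Qed.

Lemma regularM f1 f2 : regular_at f1 -> regular_at f2 -> regular_at (f1 * f2).
Proof.
move=> [p1 [q1 [n1 ->]]] [p2 [q2 [n2 ->]]].
exists (p1 * p2), (q1 * q2); rewrite rmorphM mulf_neq0//; split=> //.
by rewrite !rmorphM; field; rewrite !h_neq0.
Qed.

Lemma vanishesM f1 f2 : regular_at f1 -> vanishes_at f2 -> vanishes_at (f1 * f2).
Proof.
move=> [p1 [q1 [n1 ->]]] [p2 [q2 [n2 p20 ->]]].
exists (p1 * p2), (q1 * q2); rewrite !rmorphM mulf_neq0// p20 mulr0; split=> //.
by field; rewrite !h_neq0.
Qed.

Lemma vanishes_h p : e p = 0 -> vanishes_at (h p).
Proof. by move=> p0; exists p, 1; rewrite !rmorph1 divr1 oner_neq0. Qed.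

Lemma vanishes_regular f : vanishes_at f -> regular_at f.
Proof. by move=> [p [q [? _ ?]]]; exists p, q. Qed.

(** The value of a fraction at the point is well defined since ker h is contained
   in ker e. *)
Lemma vanishes_not1 : ~ vanishes_at 1.
Proof.
move=> [p [q [q_neq0 p0 E]]]; have hq := h_neq0 q_neq0.
have : h (p - q) = 0 by rewrite rmorphB -[h p](divfK hq) -E mul1r subrr.
by move/ker/eqP; rewrite rmorphB p0 sub0r oppr_eq0; apply/negP.
Qed.

Lemma unit_ratio p q : e p != 0 -> e q != 0 -> unit_at (h p / h q).
Proof.
move=> p0 q0; have hp := h_neq0 p0; have hq := h_neq0 q0; split.
- by rewrite mulf_neq0 ?invr_eq0.
- by exists p, q.
- by exists q, p; rewrite invf_div.
Qed.

Lemma unit_h p : e p != 0 -> unit_at (h p).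
Proof.
move=> p0; have := unit_ratio p0 (q := 1); rewrite !rmorph1 divr1; apply.
exact: oner_neq0.
Qed.

Lemma unit1 : unit_at 1.
Proof. by rewrite -(rmorph1 h); apply: unit_h; rewrite rmorph1 oner_neq0. Qed.

Lemma unitP u : unit_at u -> exists p q, [/\ e p != 0, e q != 0 & u = h p / h q].
Proof.
move=> [u0 [p [q [q0 E]]] Vu]; exists p, q; split=> //.
apply: contra_notN vanishes_not1 => /eqP p0.
rewrite -(mulVf u0); apply: vanishesM => //; by exists p, q.
Qed.

Lemma unit_not_vanishes u : unit_at u -> ~ vanishes_at u.
Proof.
move=> [u0 _ Vu] Mu; apply: vanishes_not1; rewrite -(mulVf u0).
exact: vanishesM.
Qed.

Lemma unitM u1 u2 : unit_at u1 -> unit_at u2 -> unit_at (u1 * u2).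
Proof.
move=> [? ? ?] [? ? ?]; split; first by rewrite mulf_neq0.
  exact: regularM.
by rewrite invfM; apply: regularM.
Qed.

Lemma unitV u : unit_at u -> unit_at u^-1.
Proof. by move=> [? ? ?]; split; rewrite ?invr_eq0 ?invrK. Qed.

Lemma unitXz u (n : int) : unit_at u -> unit_at (u ^ n).
Proof.
move=> Uu; have UX m : unit_at (u ^+ m).
  by elim: m => [|m IH]; [exact: unit1 | rewrite exprS; apply: unitM].
by case: n => n; [exact: UX | exact/unitV/UX].
Qed.

Lemma unit_vanishesD u f : unit_at u -> vanishes_at f -> unit_at (u + f).
Proof.
move=> /unitP[p [q [p0 q0 ->]]] [p' [q' [q'0 p'0 ->]]].
rewrite (_ : _ + _ = h (p * q' + p' * q) / h (q * q')); last first.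
  by rewrite rmorphD !rmorphM; field; rewrite !h_neq0.
apply: unit_ratio; rewrite ?rmorphD !rmorphM ?p'0 ?mul0r ?addr0 mulf_neq0//.
Qed.

Lemma uniformizers_ratio t1 t2 : uniformizes t1 -> uniformizes t2 ->
  unit_at (t1 / t2).
Proof.
move=> [n1 M1 H1] [n2 M2 H2].
have [r1 O1 E1] := H2 _ M1; have [r2 O2 E2] := H1 _ M2.
split; first by rewrite mulf_neq0 ?invr_eq0.
  by rewrite E1 mulfK.
by rewrite invf_div E2 mulfK.
Qed.

Definition has_ord t f (n : int) := unit_at (f / t ^ n).

(** Two uniformizers differ by a unit. *)
Lemma has_ord_change t1 t2 f n : uniformizes t1 -> uniformizes t2 ->
  has_ord t1 f n -> has_ord t2 f n.
Proof.
move=> U1 U2; have [n1 _ _] := U1; have [n2 _ _] := U2; rewrite /has_ord => Uf.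
have -> : f / t2 ^ n = f / t1 ^ n * (t1 / t2) ^ n.
  by rewrite expfzMl exprz_inv -invr_expz; field; rewrite !expfz_neq0.
by apply: unitM => //; apply: unitXz; apply: uniformizers_ratio.
Qed.

Context (t : K).
Hypothesis t_unif : uniformizes t.
Let t_neq0 : t != 0. Proof. by case: t_unif. Qed.
Let tz_neq0 (n : int) : t ^ n != 0. Proof. exact: expfz_neq0. Qed.

Lemma has_ord_unit u : unit_at u -> has_ord t u 0.
Proof. by rewrite /has_ord expr0z divr1. Qed.

Lemma has_ord_t : has_ord t t 1.
Proof. by rewrite /has_ord expr1z divff//; apply: unit1. Qed.

Lemma has_ordM f1 f2 n1 n2 : has_ord t f1 n1 -> has_ord t f2 n2 ->
  has_ord t (f1 * f2) (n1 + n2).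
Proof.
rewrite /has_ord => U1 U2; rewrite expfzDr// invfM mulrACA; exact: unitM.
Qed.

Lemma has_ordV f n : has_ord t f n -> has_ord t f^-1 (- n).
Proof. by rewrite /has_ord => /unitV; rewrite invfM invrK -invr_expz invrK. Qed.

Lemma has_ordX f n m : has_ord t f n -> has_ord t (f ^+ m) (n *+ m).
Proof.
move=> Uf; elim: m => [|m IH]; first exact: (has_ord_unit unit1).
by rewrite exprS mulrS; apply: has_ordM.
Qed.

Lemma vanishesX n : (0 < n)%N -> vanishes_at (t ^+ n).
Proof.
case: n => // n _; have [_ Mt _] := t_unif; rewrite exprSr; apply: vanishesM => //.
have Ot := vanishes_regular Mt.
elim: n => [|n IH]; first by rewrite expr0 -(rmorph1 h); apply: regular_h.
by rewrite exprS; apply: regularM.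
Qed.

Lemma has_ord_regular f n : has_ord t f (Posz n) -> regular_at f.
Proof.
move=> [_ O1 _]; rewrite -[f](divfK (tz_neq0 n)); apply: regularM => //.
case: n {O1} => [|n]; first by rewrite expr0z -(rmorph1 h); apply: regular_h.
exact/vanishes_regular/vanishesX.
Qed.

(** The second summand, divided by t^n1, still vanishes. *)
Lemma has_ordD f1 f2 n1 n2 : (n1 < n2)%R -> has_ord t f1 n1 -> has_ord t f2 n2 ->
  has_ord t (f1 + f2) n1.
Proof.
rewrite /has_ord => lt_n U1 [_ O2 _]; rewrite mulrDl; apply: unit_vanishesD => //.
have -> : f2 / t ^ n1 = f2 / t ^ n2 * t ^ `|n2 - n1|%N.
  rewrite -[t ^ `|_|%N]/(t ^ (`|n2 - n1|%N : int)) -mulrA; congr (_ * _).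
  have -> : (`|n2 - n1|%N : int) = n2 - n1 by lia.
  by rewrite expfzDr// mulKf// -invr_expz.
by apply: vanishesM => //; apply: vanishesX; lia.
Qed.

Lemma has_ord_unique f n1 n2 : has_ord t f n1 -> has_ord t f n2 -> n1 = n2.
Proof.
have le n m : has_ord t f n -> has_ord t f m -> (m <= n)%R.
  rewrite /has_ord => Un Um; have [//|lt_nm] := lerP m n.
  have U := unitM Un (unitV Um).
  case: (unit_not_vanishes U); have [f0 _ _] := Un.
  have -> : f / t ^ n * (f / t ^ m)^-1 = t ^ `|m - n|%N.
    have -> : (`|m - n|%N : int) = m - n by lia.
    rewrite expfzDr// -invr_expz; field; rewrite !tz_neq0.
    by apply: contraNneq f0 => ->; rewrite mul0r.
  by apply: vanishesX; lia.
by move=> U1 U2; apply/eqP; rewrite eq_le !le.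
Qed.

End Localization.

(** * Local parameters on a curve Y^2 + Q Y = P *)

Section PlaneBranch.
Context {k K : fieldType}.
Context (h : {rmorphism {poly {poly k}} -> K}).
Context (e : {rmorphism {poly {poly k}} -> k}).
Context (P Q : {poly k}) (c d : k).
Hypothesis h_eq : h 'X ^+ 2 + h Q%:P * h 'X = h P%:P.
Hypothesis h_basis : forall A B : {poly k},
  h A%:P + h B%:P * h 'X = 0 -> A = 0 /\ B = 0.
Hypothesis e_X : forall A : {poly k}, e A%:P = A.[c].
Hypothesis e_Y : e 'X = d.
Hypothesis on_branch : d ^+ 2 + Q.[c] * d = P.[c].

Lemma hC_M A B : h (A * B)%:P = h A%:P * h B%:P.
Proof. by rewrite polyCM rmorphM. Qed.

Lemma hC_B A B : h (A - B)%:P = h A%:P - h B%:P.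
Proof. by rewrite polyCB rmorphB. Qed.

Lemma hC_D A B : h (A + B)%:P = h A%:P + h B%:P.
Proof. by rewrite polyCD rmorphD. Qed.

(** Euclidean division by the monic polynomial leaves A + B Y, and (1, y) is a
   basis. *)
Lemma curve_kernel p : h p = 0 -> exists u, p = u * ('X^2 + Q%:P * 'X - P%:P).
Proof.
have [u [A [B ->]]] := reduce_quadratic P Q p.
rewrite rmorphD [h (u * _)]rmorphM rmorph_quadratic h_eq subrr mulr0 add0r.
rewrite rmorphD rmorphM => /h_basis[-> ->].
by exists u; rewrite mul0r !addr0.
Qed.

Lemma kernel_vanishes p : h p = 0 -> e p = 0.
Proof.
move=> /curve_kernel[u ->]; rewrite rmorphM rmorph_quadratic !e_X e_Y on_branch.
by rewrite subrr mulr0.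
Qed.

Lemma curve_normal_form p : exists A B : {poly k},
  h p = h A%:P + h B%:P * h 'X /\ e p = A.[c] + B.[c] * d.
Proof.
have [u [A [B ->]]] := reduce_quadratic P Q p.
exists A, B; split.
  rewrite rmorphD [h (u * _)]rmorphM rmorph_quadratic h_eq subrr mulr0 add0r.
  by rewrite rmorphD rmorphM.
rewrite rmorphD [e (u * _)]rmorphM rmorph_quadratic !e_X e_Y on_branch subrr mulr0.
by rewrite add0r rmorphD rmorphM !e_X e_Y.
Qed.

Local Notation xc := (h ('X - c%:P)%:P).
Local Notation yd := (h ('X - d%:P%:P)).

(** A + B y = (A + B d) + B (y - d), and the polynomial A + B d has the root c. *)
Lemma vanishing_generators f : vanishes_at h e f -> exists a b,
  [/\ regular_at h e a, regular_at h e b & f = a * xc + b * yd].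
Proof.
have ker := kernel_vanishes.
move=> [p [q [q0 p0 ->]]]; have [A [B [hp ep]]] := curve_normal_form p.
have /factor_theorem[A1 EA] : root (A + B * d%:P) c.
  by rewrite /root !hornerE; rewrite -ep p0.
exists (h A1%:P / h q), (h B%:P / h q); split.
- by exists A1%:P, q.
- by exists B%:P, q.
rewrite hp (_ : A = A1 * ('X - c%:P) - B * d%:P); last by rewrite -EA addrK.
rewrite hC_B !hC_M [yd]rmorphB; have := h_neq0 ker q0.
by move: (h A1%:P) (h B%:P) (h 'X) (h d%:P%:P) xc (h q) => *; field.
Qed.

(** (y - d) (y + d + Q) = P - Q d - d^2 is a polynomial in x that vanishes at c;
   the value of its cofactor is its derivative at c. *)
Lemma branch_remainder : exists r : {poly k},
  yd * (h 'X + h d%:P%:P + h Q%:P) = xc * h r%:P /\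
  r.[c] = P^`().[c] - Q^`().[c] * d.
Proof.
have /factor_theorem[r Er] : root (P - Q * d%:P - (d ^+ 2)%:P) c.
  by rewrite /root !hornerE -on_branch; apply/eqP; ring.
exists r; split; last first.
  have := congr1 (fun p => p^`().[c]) Er.
  by rewrite !derivE !hornerE subrr mulr0 add0r subr0 => <-.
have : h (P - Q * d%:P - (d ^+ 2)%:P)%:P = h (r * ('X - c%:P))%:P by rewrite Er.
rewrite (hC_B _ (d ^+ 2)%:P) (hC_B P) !hC_M -h_eq => E.
by rewrite [RHS]mulrC -E [yd]rmorphB [(d ^+ 2)%:P]polyCM hC_M; ring.
Qed.

(** The second factor of (y - d) (y + d + Q) = (x - c) r is 2d + Q(c) at the
   point, hence a unit, so y - d is a multiple of x - c. *)
Lemma uniformizes_x : 2%:R * d + Q.[c] != 0 -> uniformizes h e xc.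
Proof.
have ker := kernel_vanishes; move=> w_neq0.
have [r [Er _]] := branch_remainder.
have hE : h 'X + h d%:P%:P + h Q%:P = h ('X + d%:P%:P + Q%:P).
  by rewrite !rmorphD.
have Uden : e ('X + d%:P%:P + Q%:P) != 0.
  by rewrite !rmorphD /= !e_X e_Y hornerC; move: w_neq0; rewrite mulr_natl mulr2n.
have nden := h_neq0 ker Uden.
split.
- apply/eqP => xc0; have := (h_basis (A := 'X - c%:P) (B := 0)).
  rewrite xc0 polyC0 rmorph0 mul0r addr0 => /(_ erefl)[/eqP + _].
  by rewrite polyXsubC_eq0.
- by apply: vanishes_h; rewrite e_X !hornerE subrr.
move=> f /vanishing_generators[a [b [Ra Rb ->]]].
exists (a + b * (h r%:P / h ('X + d%:P%:P + Q%:P))).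
  apply: regularD => //; apply: regularM => //.
  by exists r%:P, ('X + d%:P%:P + Q%:P).
rewrite mulrDl; congr (_ + _); rewrite -mulrA; congr (_ * _).
apply: (mulIf nden); rewrite -{1}hE Er.
by move: (h r%:P) xc (h _) nden => u v z z_neq0; rewrite mulrAC divfK// mulrC.
Qed.

(** Writing 2d + Q = (x - c) q, the relation (y - d) (y + d + Q) = (x - c) r becomes
   (y - d)^2 = (x - c) (r - q (y - d)), where r(c) <> 0 by smoothness. *)
Lemma ramified_square : 2%:R * d + Q.[c] = 0 -> Q^`().[c] * d - P^`().[c] != 0 ->
  exists2 u, unit_at h e u & yd ^+ 2 = xc * u.
Proof.
have ker := kernel_vanishes; move=> w0 smooth_cd.
have [r [Er Erc]] := branch_remainder.
have /factor_theorem[q Eq] : root (Q + (2%:R * d)%:P) c.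
  by rewrite /root !hornerE addrC -w0.
exists (h (r%:P - q%:P * ('X - d%:P%:P))).
  apply: unit_h => //; rewrite rmorphB rmorphM rmorphB !e_X e_Y hornerC subrr.
  by rewrite mulr0 subr0 Erc -oppr_eq0 opprB.
have Eh : h Q%:P + 2%:R * h d%:P%:P = h q%:P * xc.
  rewrite -hC_M -Eq hC_D (polyCM 2%:R) hC_M; congr (_ + _ * _).
  by rewrite !polyC_natr rmorph_nat.
have -> : h (r%:P - q%:P * ('X - d%:P%:P)) = h r%:P - h q%:P * yd.
  by rewrite rmorphB rmorphM.
by rewrite mulrBr -Er mulrA [xc * _]mulrC -Eh [yd]rmorphB; ring.
Qed.

Lemma uniformizes_y : 2%:R * d + Q.[c] = 0 -> Q^`().[c] * d - P^`().[c] != 0 ->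
  uniformizes h e yd.
Proof.
have ker := kernel_vanishes; move=> w0 smooth_cd.
have [u Uu Eu] := ramified_square w0 smooth_cd; have [u0 _ Vu] := Uu.
have Vyd : vanishes_at h e yd.
  by apply: vanishes_h; rewrite rmorphB e_X e_Y hornerC subrr.
split=> //.
- apply/eqP => yd0; have := (h_basis (A := - d%:P) (B := 1)).
  rewrite polyC1 rmorph1 mul1r polyCN rmorphN addrC -rmorphB yd0.
  by move=> /(_ erefl)[_ /eqP]; rewrite oner_eq0.
move=> f /vanishing_generators[a [b [Ra Rb ->]]].
exists (a * (yd * u^-1) + b).
  apply: regularD => //; apply: regularM => //; apply: regularM => //.
  exact: vanishes_regular.
rewrite mulrDl; congr (_ + _); rewrite -!mulrA; congr (_ * _).
by rewrite [_^-1 * _]mulrC mulrA -expr2 Eu mulfK.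
Qed.


End PlaneBranch.

(** * The point at infinity *)

Section Reversal.
Context {k K : fieldType} (f : {rmorphism {poly k} -> K}).
Local Notation x := (f 'X).
Local Notation cst := (f \o polyC).
Implicit Types A : {poly k}.

(** x^n A(1/x). *)
Definition reversal n (A : {poly k}) : {poly k} := \poly_(i < n.+1) A`_(n - i).

Lemma reversalK n A : (size A <= n.+1)%N -> reversal n (reversal n A) = A.
Proof.
move=> sA; apply/polyP => i; rewrite !coef_poly; case: ltnP => [lt_i|le_i].
  by rewrite ifT; [congr (A`_ _); lia | lia].
by rewrite nth_default// (leq_trans sA).
Qed.

Lemma horner_poly_X A : f A = (map_poly cst A).[x].
Proof.
elim/poly_ind: A => [|A c IH]; first by rewrite !rmorph0 horner0.
by rewrite !rmorphD !rmorphM /= map_polyX map_polyC !hornerE -IH.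
Qed.

Lemma reversalE n A : x != 0 -> (size A <= n.+1)%N ->
  f A = x ^+ n * (map_poly cst (reversal n A)).[x^-1].
Proof.
move=> x0 sA; rewrite horner_poly_X.
have coefE : map_poly cst A = \poly_(i < n.+1) cst A`_i.
  apply/polyP => i; rewrite coef_poly coef_map; case: ltnP => // le_i.
  by rewrite nth_default ?(leq_trans sA)//= polyC0 rmorph0.
have revE : map_poly cst (reversal n A) = \poly_(i < n.+1) cst A`_(n - i).
  apply/polyP => i; rewrite coef_map [RHS]coef_poly /= /reversal coef_poly.
  by case: ltnP => // _; rewrite polyC0 rmorph0.
rewrite coefE revE !horner_poly mulr_sumr (reindex_inj rev_ord_inj) /=.
apply: eq_bigr => i _; have lt_i := ltn_ord i.
rewrite subSS mulrCA; congr (_ * _); apply: (mulIf (expf_neq0 i x0)).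
rewrite -exprD -mulrA exprVn mulVf ?expf_neq0// mulr1.
by congr (_ ^+ _); lia.
Qed.

Lemma reversal0 n A : (reversal n A).[0] = A`_n.
Proof. by rewrite horner_coef0 coef_poly subn0. Qed.

Lemma deriv_reversal0 n A : (0 < n)%N -> (reversal n A)^`().[0] = A`_n.-1.
Proof.
by move=> n_gt0; rewrite horner_coef0 coef_deriv coef_poly ltnS n_gt0 subn1.
Qed.

End Reversal.

Section AtInfinity.
Context {k K : fieldType} (f : {rmorphism {poly k} -> K}) (y : K).
Context (P Q : {poly k}) (g : nat).
Local Notation x := (f 'X).
Local Notation cst := (f \o polyC).
Hypothesis P_monic : P \is monic.
Hypothesis P_size : size P = (2 * g + 1).+1%N.
Hypothesis Q_size : (size Q <= g.+1)%N.
Hypothesis y_eq : y ^+ 2 + f Q * y = f P.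
Hypothesis f_basis : forall A B, f A + f B * y = 0 -> A = 0 /\ B = 0.
Context (h : {rmorphism {poly {poly k}} -> K}).
Context (e : {rmorphism {poly {poly k}} -> k}).
Hypothesis h_C : forall A : {poly k}, h A%:P = (map_poly cst A).[x^-1].
Hypothesis h_Y : h 'X = y / x ^+ g.+1.
Hypothesis e_C : forall A : {poly k}, e A%:P = A.[0].
Hypothesis e_Y : e 'X = 0.
Implicit Types A B : {poly k}.

(** With u = 1/x and v = y / x^(g+1), the curve becomes v^2 + Qinf(u) v = Pinf(u), of
   the same shape as the affine model, and infinity is the point (0, 0). *)
Definition Pinf : {poly k} := reversal (2 * g.+1) P.
Definition Qinf : {poly k} := reversal g.+1 Q.

Lemma poly_fun_eq0 A : f A = 0 -> A = 0.
Proof.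
move=> A0; have := f_basis (A := A) (B := 0).
by rewrite rmorph0 mul0r addr0 A0 => /(_ erefl)[].
Qed.

Lemma x_neq0 : x != 0.
Proof. by apply/eqP => /poly_fun_eq0/eqP; rewrite polyX_eq0. Qed.

Lemma at_infinityE n A : (size A <= n.+1)%N -> f A = x ^+ n * h (reversal n A)%:P.
Proof. by move=> sA; rewrite h_C -reversalE ?x_neq0. Qed.

Lemma infinity_eq : h 'X ^+ 2 + h Qinf%:P * h 'X = h Pinf%:P.
Proof.
have z0 := expf_neq0 g.+1 x_neq0.
have EQ : f Q = x ^+ g.+1 * h Qinf%:P by apply: at_infinityE; apply: leqW.
have EP : f P = (x ^+ g.+1) ^+ 2 * h Pinf%:P.
  by rewrite -exprM mulnC; apply: at_infinityE; rewrite P_size; lia.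
move: y_eq; rewrite EQ EP h_Y.
move: (x ^+ _) z0 (h Qinf%:P) (h Pinf%:P) => z z0 a b E.
apply: (mulfI (expf_neq0 2 z0)); rewrite -E; field; exact: z0.
Qed.

Lemma infinity_basis A B : h A%:P + h B%:P * h 'X = 0 -> A = 0 /\ B = 0.
Proof.
pose n := maxn (size A) (size B) => E.
have sA : (size A <= n.+1)%N by rewrite ltnW// ltnS leq_maxl.
have sB : (size B <= n.+1)%N by rewrite ltnW// ltnS leq_maxr.
have rev_size (C : {poly k}) : (size (reversal n C) <= n.+1)%N by apply: size_poly.
have hE (C : {poly k}) : (size C <= n.+1)%N -> x ^+ n * h C%:P = f (reversal n C).
  by move=> sC; rewrite (@at_infinityE n (reversal n C))// reversalK.
have [] := f_basis (A := 'X^(g.+1) * reversal n A) (B := reversal n B).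
  have z0 := expf_neq0 g.+1 x_neq0.
  rewrite rmorphM rmorphXn -!hE//.
  have -> : x ^+ g.+1 * (x ^+ n * h A%:P) + x ^+ n * h B%:P * y =
    x ^+ g.+1 * x ^+ n * (h A%:P + h B%:P * h 'X).
    by rewrite h_Y; move: (x ^+ g.+1) z0 => z z0; field; exact: z0.
  by rewrite E mulr0.
have zero (C : {poly k}) : (size C <= n.+1)%N -> reversal n C = 0 -> C = 0.
  move=> sC C0; rewrite -(reversalK sC) C0.
  by apply/polyP => i; rewrite coef_poly !coef0 if_same.
move=> /eqP; rewrite mulf_eq0 expf_eq0 polyX_eq0 andbF /= => /eqP A0 B0.
by split; apply: zero.
Qed.

(** The linear coefficient of Pinf is the leading coefficient of P: infinity is a
   smooth ramification point, where v is a uniformizer. *)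
Lemma infinity_smooth : Qinf.[0] = 0 /\ Pinf.[0] = 0 /\ Pinf^`().[0] = 1.
Proof.
split; first by rewrite reversal0 nth_default.
split; first by rewrite reversal0 nth_default// P_size; lia.
rewrite deriv_reversal0//; have /monicP := P_monic; rewrite lead_coefE P_size /=.
by rewrite (_ : (2 * g + 1)%N = (2 * g.+1).-1)//; lia.
Qed.

Let on_inf : 0 ^+ 2 + Qinf.[0] * 0 = Pinf.[0].
Proof. by have [_ [-> _]] := infinity_smooth; rewrite mulr0 addr0 expr0n. Qed.
Let ram_inf : 2%:R * 0 + Qinf.[0] = 0.
Proof. by have [-> _] := infinity_smooth; rewrite mulr0 addr0. Qed.
Let smooth_inf : Qinf^`().[0] * 0 - Pinf^`().[0] != 0.
Proof.
by have [_ [_ ->]] := infinity_smooth; rewrite mulr0 sub0r oppr_eq0 oner_neq0.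
Qed.

Lemma infinity_kernel p : h p = 0 -> e p = 0.
Proof. exact: (kernel_vanishes infinity_eq infinity_basis e_C e_Y on_inf). Qed.

Let v_eq : h ('X - 0%:P%:P) = h 'X. Proof. by rewrite !polyC0 subr0. Qed.

Lemma infinity_uniformizer : uniformizes h e (h 'X).
Proof.
have := uniformizes_y infinity_eq infinity_basis e_C e_Y on_inf ram_inf smooth_inf.
by rewrite v_eq.
Qed.

Local Notation ordinf := (has_ord h e (h 'X)).
Let ker := infinity_kernel.
Let unif := infinity_uniformizer.

Lemma ord_infinity_x : ordinf x (-2).
Proof.
have [u Uu Eu] := ramified_square infinity_eq infinity_basis e_C e_Y
  on_inf ram_inf smooth_inf.
rewrite -[x]invrK; apply: has_ordV.
have vn : h 'X != 0 by case: unif.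
have hX : h 'X%:P = x^-1 by rewrite h_C map_polyX hornerX.
move: Eu; rewrite v_eq polyC0 subr0 hX => Eu; rewrite /has_ord.
have -> : x^-1 / h 'X ^ 2 = u^-1.
  by rewrite -[h 'X ^ 2]/(h 'X ^+ 2) Eu invfM mulrA mulfV ?mul1r// invr_eq0 x_neq0.
exact: unitV.
Qed.

Lemma ord_infinity_poly n A : size A = n.+1 -> ordinf (f A) (n%:Z * -2).
Proof.
move=> sA; have -> := at_infinityE (n := n) (A := A); last by rewrite sA.
rewrite -[n%:Z * -2]addr0; apply: (has_ordM ker unif); last first.
  apply: has_ord_unit; apply: unit_h => //; rewrite e_C reversal0.
  by rewrite -[n]/(n.+1.-1) -sA -lead_coefE lead_coef_eq0 -size_poly_gt0 sA.
by rewrite -natz mulr_natl; apply: (has_ordX ker unif); apply: ord_infinity_x.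
Qed.

Lemma ord_infinity_y : ordinf y (- (2 * g + 1)%:Z).
Proof.
have -> : y = h 'X * x ^+ g.+1 by rewrite h_Y divfK ?expf_neq0 ?x_neq0.
have := has_ordX ker unif g.+1 ord_infinity_x.
move/(has_ordM ker unif (has_ord_t ker unif)).
by congr has_ord; lia.
Qed.

(** The orders of f A and f B * y at infinity have opposite parities, so no
   cancellation occurs in their sum. *)
Lemma pole_bound A B N : ordinf (f A + f B * y) (- N%:Z) ->
  (A != 0 -> (2 * (size A).-1 <= N)%N) /\
  (B != 0 -> (2 * (size B).-1 + (2 * g + 1) <= N)%N).
Proof.
move=> ordN.
have ordA : A != 0 -> ordinf (f A) (- (2 * (size A).-1)%:Z).
  rewrite -size_poly_gt0 => sA.
  have := @ord_infinity_poly (size A).-1 A; rewrite prednK// => /(_ erefl).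
  by congr has_ord; lia.
have ordB : B != 0 -> ordinf (f B * y) (- (2 * (size B).-1 + (2 * g + 1))%:Z).
  rewrite -size_poly_gt0 => sB.
  have := @ord_infinity_poly (size B).-1 B; rewrite prednK// => /(_ erefl).
  move/(has_ordM ker unif)/(_ ord_infinity_y).
  by congr has_ord; lia.
have [A0|A_neq0] := eqVneq A 0; have [B0|B_neq0] := eqVneq B 0.
- by [].
- split=> // _; move: ordN; rewrite A0 rmorph0 add0r => ordN.
  by have := has_ord_unique ker unif ordN (ordB B_neq0); lia.
- split=> // _; move: ordN; rewrite B0 rmorph0 mul0r addr0 => ordN.
  by have := has_ord_unique ker unif ordN (ordA A_neq0); lia.
have oA := ordA A_neq0; have oB := ordB B_neq0.
have [lt|lt|E] := ltgtP (2 * (size B).-1 + (2 * g + 1))%N (2 * (size A).-1)%N.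
- have oAB : ordinf (f A + f B * y) (- (2 * (size A).-1)%:Z).
    by apply: (has_ordD ker unif _ oA oB); lia.
  by have := has_ord_unique ker unif ordN oAB; lia.
- have oBA : ordinf (f A + f B * y) (- (2 * (size B).-1 + (2 * g + 1))%:Z).
    by rewrite addrC; apply: (has_ordD ker unif _ oB oA); lia.
  by have := has_ord_unique ker unif ordN oBA; lia.
- by lia.
Qed.

End AtInfinity.

(** * Local rings of the curve *)

Section Charts.
Context (k : closedFieldType) (g : nat) (E : weierstrass k g).
Local Notation K := (funfield E).
Local Notation f := (fpoly E).
Local Notation P := (wP E).
Local Notation Q := (wQ E).

(** The evaluation fev2 of the chart coordinates, packaged as a ring morphism. *)
Definition plane_eval (a b : K) : {rmorphism {poly {poly k}} -> K} :=
  horner_eval a \o (horner_eval b%:P \o map_poly (map_poly (fconst E))).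

Definition plane_point (c d : k) : {rmorphism {poly {poly k}} -> k} :=
  horner_eval c \o horner_eval d%:P.

Definition chart_fun (xi : Defs.point E) :=
  plane_eval (chart xi).1.1 (chart xi).1.2.

Definition chart_val (xi : Defs.point E) :=
  plane_point (chart xi).2.1 (chart xi).2.2.

Lemma local_ringE xi : local_ring xi = regular_at (chart_fun xi) (chart_val xi).
Proof.
rewrite /local_ring /chart_fun /chart_val.
by case: (chart xi) => [[a b] [c d]].
Qed.

Lemma max_idealE xi : max_ideal xi = vanishes_at (chart_fun xi) (chart_val xi).
Proof.
rewrite /max_ideal /chart_fun /chart_val.
by case: (chart xi) => [[a b] [c d]].
Qed.

Lemma uniformizerE xi : uniformizer xi = uniformizes (chart_fun xi) (chart_val xi).
Proof.
apply: funext => t; rewrite /uniformizer /uniformizes local_ringE max_idealE //.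
Qed.

Lemma local_unitE xi : local_unit xi = unit_at (chart_fun xi) (chart_val xi).
Proof. by apply: funext => t; rewrite /local_unit /unit_at local_ringE. Qed.

Lemma plane_evalC a b (A : {poly k}) :
  plane_eval a b A%:P = (map_poly (f \o polyC) A).[a].
Proof.
by rewrite /plane_eval /= /horner_eval map_polyC hornerC.
Qed.

Lemma plane_evalY a b : plane_eval a b 'X = b.
Proof. by rewrite /plane_eval /= /horner_eval map_polyX hornerX hornerC. Qed.

Lemma plane_pointC c d (A : {poly k}) : plane_point c d A%:P = A.[c].
Proof. by rewrite /plane_point /= /horner_eval hornerC. Qed.

Lemma plane_pointY c d : plane_point c d 'X = d.
Proof. by rewrite /plane_point /= /horner_eval hornerX hornerC. Qed.

Hypothesis E_smooth : smooth E.

Section AffinePoint.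
Context (a : affine_point E).
Local Notation c := (val a).1.
Local Notation d := (val a).2.
Local Notation h := (chart_fun (Some a)).
Local Notation e := (chart_val (Some a)).

Lemma affine_curve : d ^+ 2 + Q.[c] * d = P.[c].
Proof. by apply/eqP; case: a. Qed.

Lemma affine_smooth : 2%:R * d + Q.[c] = 0 -> Q^`().[c] * d - P^`().[c] != 0.
Proof.
move=> w0; apply/eqP => s0; exact: (E_smooth (valP a) (conj w0 s0)).
Qed.

Lemma affine_hC (A : {poly k}) : h A%:P = f A.
Proof. by rewrite plane_evalC -horner_poly_X. Qed.

Lemma affine_hY : h 'X = fy E.
Proof. exact: plane_evalY. Qed.

Lemma affine_eC (A : {poly k}) : e A%:P = A.[c].
Proof. exact: plane_pointC. Qed.

Lemma affine_eY : e 'X = d.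
Proof. exact: plane_pointY. Qed.

Lemma affine_eq : h 'X ^+ 2 + h Q%:P * h 'X = h P%:P.
Proof. rewrite !affine_hC affine_hY; exact: weierstrass_eq. Qed.

Lemma affine_basis (A B : {poly k}) :
  h A%:P + h B%:P * h 'X = 0 -> A = 0 /\ B = 0.
Proof. rewrite !affine_hC affine_hY; exact: fpoly_basis_eq0. Qed.

Lemma affine_kernel p : h p = 0 -> e p = 0.
Proof.
exact: (kernel_vanishes affine_eq affine_basis affine_eC affine_eY affine_curve).
Qed.

End AffinePoint.

Section InfinitePoint.
Local Notation h := (chart_fun (None : Defs.point E)).
Local Notation e := (chart_val (None : Defs.point E)).

Lemma infinity_hC (A : {poly k}) :
  h A%:P = (map_poly (f \o polyC) A).[(f 'X)^-1].
Proof. exact: plane_evalC. Qed.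

Lemma infinity_hY : h 'X = fy E / f 'X ^+ g.+1.
Proof. exact: plane_evalY. Qed.

Lemma infinity_eC (A : {poly k}) : e A%:P = A.[0].
Proof. exact: plane_pointC. Qed.

Lemma infinity_eY : e 'X = 0.
Proof. exact: plane_pointY. Qed.

Lemma infinite_uniformizer : uniformizes h e (h 'X).
Proof.
exact: (infinity_uniformizer (wP_monic E) (wP_size E) (wQ_size E)
  (weierstrass_eq E) (@fpoly_basis_eq0 _ _ E) infinity_hC infinity_hY
  infinity_eC infinity_eY).
Qed.

Lemma infinite_ord_poly n (A : {poly k}) : size A = n.+1 ->
  has_ord h e (h 'X) (f A) (n%:Z * -2).
Proof.
exact: (ord_infinity_poly (wP_monic E) (wP_size E) (wQ_size E)
  (weierstrass_eq E) (@fpoly_basis_eq0 _ _ E) infinity_hC infinity_hY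
  infinity_eC infinity_eY).
Qed.

Lemma infinite_pole_bound (A B : {poly k}) N :
  has_ord h e (h 'X) (f A + f B * fy E) (- N%:Z) ->
  (A != 0 -> (2 * (size A).-1 <= N)%N) /\
  (B != 0 -> (2 * (size B).-1 + (2 * g + 1) <= N)%N).
Proof.
exact: (pole_bound (wP_monic E) (wP_size E) (wQ_size E)
  (weierstrass_eq E) (@fpoly_basis_eq0 _ _ E) infinity_hC infinity_hY
  infinity_eC infinity_eY).
Qed.

Lemma infinite_kernel p : h p = 0 -> e p = 0.
Proof.
exact: (infinity_kernel (wP_monic E) (wP_size E) (wQ_size E) (weierstrass_eq E)
  (@fpoly_basis_eq0 _ _ E) infinity_hC infinity_hY infinity_eC infinity_eY).
Qed.

End InfinitePoint.

Lemma chart_kernel xi p : chart_fun xi p = 0 -> chart_val xi p = 0.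
Proof. by case: xi => [a|]; [exact: affine_kernel | exact: infinite_kernel]. Qed.

(** The order may be read off any single uniformizer. *)
Lemma has_orderP xi t u n : uniformizes (chart_fun xi) (chart_val xi) t ->
  has_order xi u n <-> has_ord (chart_fun xi) (chart_val xi) t u n.
Proof.
move=> t_unif; rewrite /has_order uniformizerE local_unitE; split=> [H|H t' t'_unif].
  exact: H.
exact: (has_ord_change (@chart_kernel xi) t_unif t'_unif H).
Qed.

End Charts.

Lemma quotient_of_square (K : fieldType) (t u v : K) :
  t ^+ 2 = v * u -> t != 0 -> u != 0 -> v / t ^+ 2 = u^-1.
Proof.
move=> Et t0 u0; apply: (canLR (mulfK (expf_neq0 2 t0))).
by rewrite Et mulrC mulfK.
Qed.

(** * Divisors of the functions x - c *)

Section VerticalDivisors.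
Context (k : closedFieldType) (g : nat) (E : weierstrass k g).
Hypothesis E_smooth : smooth E.
Local Notation K := (funfield E).
Local Notation f := (fpoly E).
Local Notation P := (wP E).
Local Notation Q := (wQ E).

Lemma conj_on_curve (a : affine_point E) :
  on_curve E ((val a).1, - Q.[(val a).1] - (val a).2).
Proof. by rewrite /on_curve /= -affine_curve; apply/eqP; ring. Qed.

(** The image under the hyperelliptic involution y |-> -Q - y. *)
Definition conj_point (a : affine_point E) : affine_point E :=
  exist _ ((val a).1, - Q.[(val a).1] - (val a).2) (conj_on_curve a).

Lemma same_abscissa (a b : affine_point E) : (val b).1 = (val a).1 ->
  b = a \/ b = conj_point a.
Proof.
move=> eq_x; have Ea := affine_curve a; have := affine_curve b; rewrite eq_x => Eb.
have : ((val b).2 - (val a).2) * ((val b).2 - (- Q.[(val a).1] - (val a).2)) = 0.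
  by rewrite -(subrr P.[(val a).1]) -{1}Eb -Ea; ring.
move/eqP; rewrite mulf_eq0 !subr_eq0 => /orP[/eqP eq_y|/eqP eq_y]; [left|right];
  apply: val_inj; rewrite [LHS]surjective_pairing eq_x eq_y //.
by rewrite -surjective_pairing.
Qed.

(** The fixed points of the involution are the ramification points of x. *)
Lemma conj_fixed a : (conj_point a == a) = (2%:R * (val a).2 + Q.[(val a).1] == 0).
Proof.
apply/eqP/eqP => [/(congr1 (fun z : affine_point E => (val z).2)) /= Ey|w0].
  transitivity ((val a).2 - (- Q.[(val a).1] - (val a).2)); first by ring.
  by rewrite Ey subrr.
apply: val_inj; rewrite [RHS]surjective_pairing /=; congr (_, _).
by apply: subr0_eq; rewrite -[RHS]oppr0 -w0; ring.
Qed.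

Lemma vertical_ramified (a : affine_point E) :
  2%:R * (val a).2 + Q.[(val a).1] = 0 ->
  has_order (Some a) (f ('X - (val a).1%:P)) 2.
Proof.
move=> w0; have s0 := affine_smooth E_smooth w0.
have U := uniformizes_y (affine_eq a) (@affine_basis _ _ _ a) (affine_eC a)
  (affine_eY a) (affine_curve a) w0 s0.
have [u Uu Eu] := ramified_square (affine_eq a) (@affine_basis _ _ _ a)
  (affine_eC a) (affine_eY a) (affine_curve a) w0 s0.
apply/(has_orderP _ _ U); rewrite /has_ord -(affine_hC a).
have [t0 _ _] := U; have [u0 _ _] := Uu.
rewrite (_ : _ / _ = u^-1); first exact: unitV.
rewrite -[_ ^ 2]/(_ ^+ 2).
exact: quotient_of_square Eu t0 u0.
Qed.

Lemma vertical_unramified (a : affine_point E) :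
  2%:R * (val a).2 + Q.[(val a).1] != 0 ->
  uniformizes (chart_fun (Some a)) (chart_val (Some a)) (f ('X - (val a).1%:P)).
Proof.
move=> w0; rewrite -(affine_hC a).
exact: (uniformizes_x (affine_eq a) (@affine_basis _ _ _ a) (affine_eC a)
  (affine_eY a) (affine_curve a) w0).
Qed.

Lemma affine_uniformizer (a : affine_point E) : exists t,
  uniformizes (chart_fun (Some a)) (chart_val (Some a)) t.
Proof.
have [w0|w0] := eqVneq (2%:R * (val a).2 + Q.[(val a).1]) 0.
  have s0 := affine_smooth E_smooth w0.
  exists (chart_fun (Some a) ('X - (val a).2%:P%:P)).
  exact: (uniformizes_y (affine_eq a) (@affine_basis _ _ _ a) (affine_eC a)
    (affine_eY a) (affine_curve a) w0 s0).
by exists (f ('X - (val a).1%:P)); apply: vertical_unramified.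
Qed.

Definition vertical_divisor (a : affine_point E) : {freeg Defs.point E} :=
  << Some a >> + << Some (conj_point a) >> - << None >> *+ 2.

(** At a ramification point a = conj_point a and x - c is a square up to a unit; this
   agrees with the coefficient 2 of the divisor there. *)
Lemma vertical_div (a : affine_point E) :
  is_div (f ('X - (val a).1%:P)) (vertical_divisor a).
Proof.
have coeffE xi : coeff xi (vertical_divisor a) =
    (Some a == xi)%:R + (Some (conj_point a) == xi)%:R - (None == xi)%:R *+ 2.
  by rewrite coeffB coeffD coeffMn !coeffU !mul1r.
split; first by rewrite fpoly_eq0 polyXsubC_eq0.
case=> [b|]; rewrite coeffE; last first.
  apply/(has_orderP _ _ (infinite_uniformizer E)).
  have := infinite_ord_poly E (n := 1) (size_XsubC (val a).1).
  by congr has_ord.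
rewrite (_ : None == Some b = false) // mul0rn subr0.
rewrite -![Some _ == Some b]/(_ == b).
have [eq_x|neq_x] := eqVneq (val b).1 (val a).1; last first.
  rewrite (_ : a == b = false); last first.
    by apply: contraNF neq_x => /eqP ->.
  rewrite (_ : conj_point a == b = false); last first.
    by apply: contraNF neq_x => /eqP <-.
  have [t U] := affine_uniformizer b; apply/(has_orderP _ _ U).
  rewrite addr0; apply: has_ord_unit; rewrite -(affine_hC b).
  apply: unit_h; first exact: affine_kernel.
  by rewrite affine_eC !hornerE subr_eq0.
rewrite -eq_x.
have conjb : conj_point a == b = (a == conj_point b).
  apply/eqP/eqP => [<-|->]; apply: val_inj.
    by rewrite [LHS]surjective_pairing /=; congr (_, _); ring.
  by rewrite [RHS]surjective_pairing /=; congr (_, _); ring.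
have [w0|w0] := eqVneq (2%:R * (val b).2 + Q.[(val b).1]) 0.
  have fixb : conj_point b = b by apply/eqP; rewrite conj_fixed w0.
  have -> : a = b by have [] := same_abscissa (esym eq_x); rewrite ?fixb.
  by rewrite fixb eqxx; apply: vertical_ramified.
have U := vertical_unramified w0; apply/(has_orderP _ _ U).
have -> : (a == b)%:R + (conj_point a == b)%:R = 1 :> int.
  rewrite conjb; have [->|->] := same_abscissa (esym eq_x).
    by rewrite eqxx eq_sym conj_fixed (negPf w0).
  by rewrite eqxx conj_fixed (negPf w0).
by apply: has_ord_t => //; exact: affine_kernel.
Qed.

End VerticalDivisors.

(** Differentiating at the double root d leaves q(d) b = 0. *)
Lemma double_root_cancel (k : fieldType) (q r : {poly k}) (a b d s t : k) :
  - (q * (a%:P + b%:P * 'X)) = r * ('X^2 + s%:P * 'X - t%:P) ->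
  a + b * d = 0 -> d ^+ 2 + s * d = t -> 2%:R * d + s = 0 -> q.[d] != 0 -> b = 0.
Proof.
have derivCX c : (c%:P * 'X)^`() = c%:P :> {poly k}.
  by rewrite derivM derivC derivX mul0r add0r mulr1.
move=> E ab0 ds0 w0 q0; have := congr1 (fun D => D^`().[d]) E.
have -> : (- (q * (a%:P + b%:P * 'X)))^`().[d] =
    - (q^`().[d] * (a + b * d) + q.[d] * b).
  rewrite derivN derivM derivD derivC add0r derivCX.
  by rewrite !(hornerN, hornerD, hornerM, hornerC, hornerX).
have -> : (r * ('X^2 + s%:P * 'X - t%:P))^`().[d] =
    r^`().[d] * (d ^+ 2 + s * d - t) + r.[d] * (2%:R * d + s).
  rewrite derivM derivB derivD derivC subr0 derivCX derivXn.
  rewrite !(hornerN, hornerD, hornerM, hornerC, hornerX, hornerXn, hornerMn).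
  by rewrite mulr_natl mulr2n; ring.
rewrite ab0 ds0 w0 subrr !mulr0 add0r addr0 => /eqP.
by rewrite oppr_eq0 mulf_eq0 (negPf q0) => /eqP.
Qed.

(** * Functions attached to torsion points *)

Section TorsionFunctions.
Context (k : closedFieldType) (g : nat) (E : weierstrass k g).
Hypothesis E_smooth : smooth E.
Local Notation K := (funfield E).
Local Notation f := (fpoly E).
Local Notation P := (wP E).
Local Notation Q := (wQ E).

Lemma div0_valMn (D : div0 E) n : div0_val (D *+ n) = div0_val D *+ n.
Proof. by elim: n => [|n IH] //; rewrite !mulrS -IH. Qed.

Lemma pi_principal_eq0 (D : div0 E) :
  (\pi_(Quotient.quot (principal E)) D == 0 :> jacobian E)%qT =
  (D \in principal E).
Proof.
rewrite -[in RHS](subr0 D) Quotient.idealrBE; congr (_ == _).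
by rewrite raddf0.
Qed.

Lemma aj_multiple_eq0 (xi : Defs.point E) n : aj xi *+ n = 0 <->
  exists u, is_div u ((<< xi >> - << None >>) *+ n).
Proof.
rewrite /aj -raddfMn /=.
split=> [/eqP|].
  by rewrite pi_principal_eq0 => /asboolP[u]; rewrite div0_valMn; exists u.
move=> [u Hu]; apply/eqP; rewrite pi_principal_eq0; apply/asboolP; exists u.
by rewrite div0_valMn.
Qed.

(** The divisor of x - c is [a] + [conj a] - 2[oo]. *)
Lemma aj_conj (a : affine_point E) : aj (Some a) + aj (Some (conj_point a)) = 0.
Proof.
rewrite /aj -raddfD /=; apply/eqP; rewrite pi_principal_eq0; apply/asboolP.
exists (f ('X - (val a).1%:P)).
have := vertical_div E_smooth a; congr (is_div _ _).
by rewrite /vertical_divisor /= mulr2n opprD addrACA.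
Qed.

Lemma aj_infinity : aj (None : Defs.point E) = 0.
Proof.
apply/eqP; rewrite pi_principal_eq0 (_ : Div0 _ = 0) ?rpred0//.
by apply: val_inj; rewrite /= subrr.
Qed.

Lemma torsion_infinity N : ~ curve_torsion E N None.
Proof. by move=> [_]; apply; rewrite /torsion /= aj_infinity mul0rn. Qed.

Lemma torsion_conj N (a : affine_point E) : curve_torsion E N (Some a) ->
  curve_torsion E N (Some (conj_point a)).
Proof.
have ajC : aj (Some (conj_point a)) = - aj (Some a).
  by apply/eqP; rewrite -addr_eq0 addrC aj_conj.
rewrite /curve_torsion /= /torsion_tilde /torsion /= ajC => -[aN a2].
split; rewrite /= mulNrn ?aN ?oppr0//.
by move=> /eqP; rewrite oppr_eq0 => /eqP.
Qed.

(** At a ramification point a = conj_point a, so twice the class of a is 0. *)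
Lemma torsion_unramified N (a : affine_point E) : curve_torsion E N (Some a) ->
  2%:R * (val a).2 + Q.[(val a).1] != 0.
Proof.
move=> [_ a2]; apply: contra_notN a2 => w0.
rewrite /torsion /= mulr2n -[X in _ + X](_ : aj (Some (conj_point a)) = _).
  exact: aj_conj.
by congr (aj (Some _)); apply/eqP; rewrite conj_fixed.
Qed.

Lemma affine_point_over (c : k) : exists a : affine_point E, (val a).1 = c.
Proof.
have /closed_rootP[d] : size ('X^2 + (Q.[c]%:P * 'X - P.[c]%:P)) != 1.
  rewrite size_polyDl size_polyXn// (leq_ltn_trans (size_polyD _ _))// gtn_max.
  rewrite size_polyN (leq_ltn_trans (size_polyC_leq1 _)) ?andbT//.
  by rewrite mul_polyC (leq_ltn_trans (size_scale_leq _ _))// size_polyX.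
rewrite /root !hornerE ?addrA subr_eq0 => on.
by exists (exist (fun z => on_curve E z) (c, d) on).
Qed.

Section RegularFraction.
Context (u : K) (A B C : {poly k}) (a : affine_point E).
Hypothesis u_eq : u * f C = f A + f B * fy E.
Hypothesis u_reg : local_ring (Some a) u.
Local Notation c := (val a).1.
Local Notation d := (val a).2.
Hypothesis C_root : C.[c] = 0.

Lemma regular_fraction_curve_eq : exists p q r, chart_val (Some a) q != 0 /\
  p * C%:P - q * (A%:P + B%:P * 'X) = r * ('X^2 + Q%:P * 'X - P%:P).
Proof.
move: u_reg; rewrite local_ringE => -[p [q [q0 Eu]]].
have hq := h_neq0 (@affine_kernel _ _ _ a) q0.
have [|r Er] := curve_kernel (affine_eq a) (@affine_basis _ _ _ a)
    (p := p * C%:P - q * (A%:P + B%:P * 'X)); last by exists p, q, r.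
rewrite rmorphB !rmorphM rmorphD rmorphM !affine_hC affine_hY -u_eq Eu.
by rewrite mulrA [_ * (_ / _)]mulrC divfK ?subrr.
Qed.

Lemma regular_fraction_value : A.[c] + B.[c] * d = 0.
Proof.
have [p [q [r [q0 Er]]]] := regular_fraction_curve_eq.
have := congr1 (chart_val (Some a)) Er.
rewrite rmorphB !rmorphM rmorph_quadratic rmorphD rmorphM !affine_eC affine_eY.
rewrite C_root affine_curve subrr !mulr0 sub0r => /eqP.
by rewrite oppr_eq0 mulf_eq0 (negPf q0) => /eqP.
Qed.

(** Setting x = c in the identity p C - q (A + B y) = r (y^2 + Q y - P) gives an
   identity between polynomials in y whose right-hand side has the double root d,
   while q does not vanish at d. *)
Lemma regular_fraction_ramified : conj_point a = a -> B.[c] = 0.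
Proof.
move=> /eqP; rewrite conj_fixed => /eqP w0.
have [p [q [r [q0 Er]]]] := regular_fraction_curve_eq.
pose phi : {rmorphism {poly {poly k}} -> {poly k}} := map_poly (horner_eval c).
have phiC (D : {poly k}) : phi D%:P = D.[c]%:P by rewrite /phi /= map_polyC.
have phiX : phi 'X = 'X by rewrite /phi /= map_polyX.
have phi_q : (phi q).[d] = chart_val (Some a) q.
  rewrite /phi /= -[d in LHS](hornerC d c) -[(d%:P).[c]]/(horner_eval c d%:P).
  by rewrite horner_map.
have := congr1 phi Er.
rewrite rmorphB !rmorphM rmorph_quadratic rmorphD rmorphM !phiC phiX C_root.
rewrite polyC0 mulr0 sub0r => /(@double_root_cancel _ _ _ _ _ d); apply => //.
- exact: regular_fraction_value.
- exact: affine_curve.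
- by rewrite phi_q.
Qed.

End RegularFraction.

(** If C has a root c, regularity at the points over c makes A + B y vanish twice on
   that fibre, so x - c divides A, B and C; the induction is on the degree of C. *)
Lemma affine_regular (u : K) :
  (forall a : affine_point E, local_ring (Some a) u) ->
  exists A B : {poly k}, u = f A + f B * fy E.
Proof.
move=> u_reg; have [A [B [C [C0 Eu]]]] : exists A B C : {poly k}, C != 0 /\
    u * f C = f A + f B * fy E.
  apply: (quadratic_fraction _ _ (@ffrac_basis_span _ _ E) u).
    by move=> p; rewrite tofrac_eq0.
  exact: fractionP.
have [n le_n] : exists n, (size C <= n)%N by exists (size C).
elim: n => [|n IH] in A B C C0 Eu le_n *.
  by move: C0; rewrite -size_poly_leq0 le_n.
have [/eqP sC|/closed_rootP[c Cc]] := boolP (size C == 1).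
  have /size_poly1P[c c0 Ec] : size C == 1 by rewrite sC.
  exists (c^-1%:P * A), (c^-1%:P * B).
  have fc : f c%:P != 0 by rewrite fpoly_eq0 polyC_eq0.
  apply: (mulIf fc); rewrite -Ec Eu !rmorphM mulrDl; congr (_ + _).
    by rewrite mulrAC -rmorphM Ec -polyCM mulVf// polyC1 rmorph1 mul1r.
  rewrite mulrAC; congr (_ * _).
  by rewrite mulrAC -rmorphM Ec -polyCM mulVf// polyC1 rmorph1 mul1r.
have [a ac] := affine_point_over c.
have Ca : C.[(val a).1] = 0 by rewrite ac; apply/rootP.
have vA := regular_fraction_value Eu (u_reg a) Ca.
have vB : B.[(val a).1] = 0.
  have [fix_a|conj_neq] := eqVneq (conj_point a) a.
    exact: (regular_fraction_ramified Eu (u_reg a) Ca fix_a).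
  have := regular_fraction_value Eu (u_reg (conj_point a)) Ca.
  rewrite -[RHS]vA /= => /addrI/eqP; rewrite -subr_eq0 -mulrBr mulf_eq0.
  move=> /orP[/eqP//|].
  rewrite (_ : _ - _ - _ = - (2%:R * (val a).2 + Q.[(val a).1])); last by ring.
  by rewrite oppr_eq0 -conj_fixed (negPf conj_neq).
move: vA; rewrite vB mul0r addr0 => vA.
have /factor_theorem[A1 EA] : root A (val a).1 by apply/rootP.
have /factor_theorem[B1 EB] : root B (val a).1 by apply/rootP.
have /factor_theorem[C1 EC] : root C (val a).1 by apply/rootP.
have fx0 : f ('X - (val a).1%:P) != 0 by rewrite fpoly_eq0 polyXsubC_eq0.
have C10 : C1 != 0 by apply: contraNneq C0 => C10; rewrite EC C10 mul0r.
apply: (IH A1 B1 C1 C10).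
  apply: (mulIf fx0); rewrite mulrDl -mulrA -rmorphM -EC Eu EA EB !rmorphM.
  by rewrite [_ * fy E]mulrAC.
by move: le_n; rewrite EC size_mul ?polyXsubC_eq0// size_XsubC addn2.
Qed.

End TorsionFunctions.

Lemma cross_multiply (K : fieldType) (u t p q : K) :
  t != 0 -> q != 0 -> u / t = p / q -> u * q = t * p.
Proof.
by move=> t0 q0 E; rewrite -[u](divfK t0) E mulrAC divfK// mulrC.
Qed.

Section TorsionFunction.
Context (k : closedFieldType) (g : nat) (E : weierstrass k g).
Hypothesis E_smooth : smooth E.
Local Notation f := (fpoly E).

(** The function with divisor N[a] - N[oo].  The last clause says that it is divisible
   by (x - x0)^N in the local ring at a. *)
Lemma torsion_function N (a : affine_point E) : curve_torsion E N (Some a) ->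
  exists A B : {poly k},
  [/\ f A + f B * fy E != 0,
      A != 0 -> (2 * (size A).-1 <= N)%N,
      B != 0 -> (2 * (size B).-1 + (2 * g + 1) <= N)%N
    & exists p q, chart_val (Some a) q != 0 /\
      (f A + f B * fy E) * chart_fun (Some a) q =
      f ('X - (val a).1%:P) ^+ N * chart_fun (Some a) p].
Proof.
move=> tors; have w0 := torsion_unramified E_smooth tors.
case: tors => /aj_multiple_eq0[u [u0 divu]] _.
have coeffE xi : coeff xi ((<< Some a >> - << None >>) *+ N) =
    N%:Z * (Some a == xi)%:R - N%:Z * (None == xi)%:R.
  have natE (b : bool) : b%:R *+ N = N%:Z * b%:R.
    by case: b; rewrite ?mulr1 ?mulr0 ?mul0rn ?natz.
  by rewrite coeffMn coeffB !coeffU !mul1r mulrnBl !natE.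
have u_reg b : local_ring (Some b) u.
  have [t U] := affine_uniformizer E_smooth b.
  have := divu (Some b); rewrite coeffE => /(has_orderP _ _ U).
  rewrite (_ : None == Some b = false)// mulr0 subr0 local_ringE.
  have reg := has_ord_regular (@affine_kernel _ _ _ b) U.
  by case: (_ == _); rewrite ?mulr1 ?mulr0; apply: reg.
have [A [B Eu]] := affine_regular u_reg; exists A, B; rewrite -Eu.
have [boundA boundB] : (A != 0 -> (2 * (size A).-1 <= N)%N) /\
    (B != 0 -> (2 * (size B).-1 + (2 * g + 1) <= N)%N).
  apply: (@infinite_pole_bound _ _ E A B N); have := divu None; rewrite -Eu.
  rewrite coeffE => /(has_orderP _ _ (infinite_uniformizer E)).
  by rewrite eqxx (_ : Some a == None = false)// mulr0 sub0r mulr1.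
split=> //.
have U := vertical_unramified w0.
have := divu (Some a); rewrite coeffE => /(has_orderP _ _ U).
rewrite eqxx (_ : None == Some a = false)// mulr0 subr0 mulr1.
move=> [_ [p [q [q0 Epq]]] _].
exists p, q; split=> //; have [t0 _ _] := U.
have hq := h_neq0 (@affine_kernel _ _ _ a) q0.
by apply: (cross_multiply (expf_neq0 N t0) hq Epq).
Qed.

End TorsionFunction.

(** * Power series expansion of y *)

Section BranchExpansion.
Context {k : fieldType} (P Q : {poly k}) (c d : k).
Hypothesis on_curve_cd : d ^+ 2 + Q.[c] * d = P.[c].
Hypothesis w_neq0 : 2%:R * d + Q.[c] != 0.
Implicit Types A B Y : {poly k}.
Local Notation sh A := (A \Po ('X + c%:P)).

Lemma horner0_shift A : (sh A).[0] = A.[c].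
Proof. by rewrite horner_comp !hornerE. Qed.

Lemma dvdX_root0 A : A.[0] = 0 -> 'X %| A.
Proof. by move=> A0; rewrite -['X]subr0 -polyC0 dvdp_XsubCl; apply/rootP. Qed.

(** Hensel's lemma: the branch of the curve at a point that is not a ramification
   point of x is the graph of a power series in x - c. *)
Lemma branch_expansion n : exists Y,
  Y.[0] = d /\ 'X^n %| Y ^+ 2 + sh Q * Y - sh P.
Proof.
suff [Y [Y0 Yn]] : exists Y, Y.[0] = d /\ 'X^(n.+1) %| Y ^+ 2 + sh Q * Y - sh P.
  by exists Y; split=> //; apply: dvdp_trans Yn; rewrite exprS dvdp_mull.
elim: n => [|n [Y [Y0 /dvdpP[r Er]]]].
  exists d%:P; rewrite hornerC; split=> //; rewrite expr1; apply: dvdX_root0.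
  by rewrite !hornerE !horner0_shift on_curve_cd subrr.
(* z makes the constant term of the next remainder vanish *)
pose z := - r.[0] / (2%:R * d + Q.[c]).
exists (Y + z%:P * 'X^(n.+1)); split.
  by rewrite hornerD hornerM hornerXn expr0n mulr0 addr0.
have -> : (Y + z%:P * 'X^(n.+1)) ^+ 2 + sh Q * (Y + z%:P * 'X^(n.+1)) - sh P =
    'X^(n.+1) * (r + z%:P * (2%:R * Y + sh Q) + z%:P ^+ 2 * 'X^(n.+1)).
  rewrite (_ : _ - _ = (Y ^+ 2 + sh Q * Y - sh P) +
    'X^(n.+1) * (z%:P * (2%:R * Y + sh Q) + z%:P ^+ 2 * 'X^(n.+1))); last by ring.
  by rewrite Er; ring.
rewrite [X in X %| _]exprSr dvdp_mul//; apply: dvdX_root0.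
have w0 : (2%:R * Y + sh Q).[0] = 2%:R * d + Q.[c].
  by rewrite hornerD hornerM horner0_shift Y0 -polyC_natr hornerC.
rewrite hornerD [X in X + _]hornerD hornerM w0 hornerM hornerXn expr0n mulr0 addr0.
by rewrite hornerC /z divfK// addrN.
Qed.

Definition branch_eval Y : {rmorphism {poly {poly k}} -> {poly k}} :=
  horner_eval Y \o map_poly (comp_poly ('X + c%:P)).

Lemma branch_evalC Y A : branch_eval Y A%:P = sh A.
Proof. by rewrite /branch_eval /= /horner_eval map_polyC hornerC. Qed.

Lemma branch_evalY Y : branch_eval Y 'X = Y.
Proof. by rewrite /branch_eval /= /horner_eval map_polyX hornerX. Qed.

Lemma branch_eval0 Y q (e : {rmorphism {poly {poly k}} -> k}) :
  (forall A, e A%:P = A.[c]) -> e 'X = d -> Y.[0] = d ->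
  (branch_eval Y q).[0] = e q.
Proof.
move=> eC eX Y0; elim/poly_ind: q => [|q A IH].
  by rewrite !rmorph0 horner0.
rewrite !rmorphD !rmorphM hornerD hornerM IH branch_evalC branch_evalY Y0.
by rewrite horner0_shift eC eX.
Qed.

(** Vanishing to order N in the local ring means vanishing to order N along the
   power series expansion. *)
Lemma branch_vanishing Y N A B (p q r : {poly {poly k}})
    (e : {rmorphism {poly {poly k}} -> k}) :
  (forall A, e A%:P = A.[c]) -> e 'X = d -> Y.[0] = d ->
  'X^N %| Y ^+ 2 + sh Q * Y - sh P -> e q != 0 ->
  (A%:P + B%:P * 'X) * q - ('X - c%:P)%:P ^+ N * p =
    r * ('X^2 + Q%:P * 'X - P%:P) ->
  'X^N %| sh A + sh B * Y.
Proof.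
move=> eC eX Y0 YN q0 /(congr1 (branch_eval Y)).
rewrite rmorphB !rmorphM rmorphXn rmorphD rmorphM rmorph_quadratic.
rewrite !branch_evalC branch_evalY comp_polyB comp_polyX comp_polyC addrK.
move=> /eqP; rewrite subr_eq => /eqP E.
have : 'X^N %| (sh A + sh B * Y) * branch_eval Y q.
  by rewrite E; apply: dvdp_add; [exact: dvdp_mull | exact: dvdp_mulr].
rewrite Gauss_dvdpl//; apply: coprimep_expl.
rewrite coprimep_sym -['X]subr0 -polyC0 coprimep_XsubC /root.
by rewrite (branch_eval0 _ eC eX Y0).
Qed.

End BranchExpansion.

Lemma in_qpolyXn_eq0 (k : fieldType) (p : {poly k}) M : (0 < M)%N ->
  in_qpoly 'X^M p = 0 <-> 'X^M %| p.
Proof.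
move=> M0.
have mkM : mk_monic 'X^M = 'X^M :> {poly k} by rewrite mk_monic_Xn prednK.
have E : in_qpoly 'X^M p = p %% 'X^M :> {poly k}.
  by rewrite /= mkM -Pdiv.IdomainMonic.modpE ?monicXn.
split=> [p0|]; first by apply/modp_eq0P; rewrite -E p0.
by move=> /modp_eq0P p0; apply: val_inj; rewrite [LHS]E p0.
Qed.

Lemma dvdp_Xn_nderivn (k : fieldType) (p : {poly k}) N n :
  'X^N %| p -> 'X^(N - n) %| p^`N(n).
Proof. by move=> /dvdpP h; apply/dvdpP/dvdXn_nderivn. Qed.

Section BranchNumerators.
Context {R : comNzRingType} {k : fieldType} (sp : {rmorphism {poly R} -> {poly k}}).
Context (PU QU : {poly R}) (g : nat) (s : nat -> {poly R}).
Hypothesis sp_nderivn : forall p n, sp p^`N(n) = (sp p)^`N(n).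
Hypothesis s_natural : forall n, (g < n)%N ->
  forall (B : comNzRingType) (phi : {rmorphism {poly R} -> B}) (z : nat -> B),
  (forall m, (m <= n)%N ->
     solves phi (fun j => PU^`N(j)) (fun j => QU^`N(j)) z m) ->
  (2%:R * z 0 + phi QU) ^+ (2 * n - 1) * z n = phi (s n).
Context (c : k).
Local Notation sh A := (A \Po ('X + c%:P)).
Local Notation P := (sp PU).
Local Notation Q := (sp QU).

(** Along a branch Y known modulo X^N, the Hasse derivatives of Y satisfy the
   equations of index at most n modulo X^(N-n); the natural formula is applied in
   the quotient ring. *)
Lemma branch_numerator (Y : {poly k}) N n : (g < n)%N ->
  'X^N %| Y ^+ 2 + sh Q * Y - sh P ->
  'X^(N - n) %| (2%:R * Y + sh Q) ^+ (2 * n - 1) * Y^`N(n) - sh (sp (s n)).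
Proof.
move=> lt_gn YN; have [->|M0] := posnP (N - n)%N; first by rewrite expr0 dvd1p.
pose quo : {rmorphism {poly k} -> {poly %/ 'X^(N - n)}} := in_qpoly 'X^(N - n).
pose phi : {rmorphism {poly R} -> {poly %/ 'X^(N - n)}} :=
  quo \o (comp_poly ('X + c%:P) \o sp).
have phiE p : phi p = quo (sh (sp p)) by [].
have quo_eq0 p : 'X^(N - n) %| p -> quo p = 0.
  by move=> /in_qpolyXn_eq0; apply.
have sol m : (m <= n)%N ->
    solves phi (fun j => PU^`N(j)) (fun j => QU^`N(j)) (fun j => quo Y^`N(j)) m.
  move=> le_mn; rewrite /solves phiE sp_nderivn -nderivn_shift.
  have -> : \sum_(j < m.+1) quo Y^`N(j) * quo Y^`N(m - j) = quo (Y * Y)^`N(m).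
    by rewrite nderivnM rmorph_sum; apply: eq_bigr => j _; rewrite -rmorphM.
  have -> : \sum_(j < m.+1) phi QU^`N(j) * quo Y^`N(m - j) =
      quo (sh Q * Y)^`N(m).
    rewrite nderivnM rmorph_sum; apply: eq_bigr => j _.
    by rewrite phiE sp_nderivn -nderivn_shift -rmorphM.
  apply: subr0_eq; rewrite -rmorphD -rmorphB -nderivnD -nderivnB; apply: quo_eq0.
  apply: (dvdp_trans (dvdp_exp2l _ _)); last exact: dvdp_Xn_nderivn YN.
  by lia.
have := s_natural lt_gn sol.
rewrite !phiE nderivn0 -(rmorph_nat quo 2) -rmorphM -rmorphD -rmorphXn -rmorphM.
move=> /eqP; rewrite -subr_eq0 -rmorphB => /eqP.
by move/(in_qpolyXn_eq0 _ M0).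
Qed.

End BranchNumerators.

(** * Multiplicity of the zeros of the determinant *)

Section Multiplicity.
Context {R : comNzRingType} {k : fieldType} (sp : {rmorphism {poly R} -> {poly k}}).
Context (PU QU : {poly R}) (g : nat) (s : nat -> {poly R}).
Hypothesis sp_nderivn : forall p n, sp p^`N(n) = (sp p)^`N(n).
Hypothesis s_natural : forall n, (g < n)%N ->
  forall (B : comNzRingType) (phi : {rmorphism {poly R} -> B}) (z : nat -> B),
  (forall m, (m <= n)%N ->
     solves phi (fun j => PU^`N(j)) (fun j => QU^`N(j)) z m) ->
  (2%:R * z 0 + phi QU) ^+ (2 * n - 1) * z n = phi (s n).
Context (c d : k).
Local Notation sh A := (A \Po ('X + c%:P)).
Local Notation P := (sp PU).
Local Notation Q := (sp QU).
Local Notation F := (4%:R * P + Q ^+ 2).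
Hypothesis w_neq0 : 2%:R * d + Q.[c] != 0.
Hypothesis on_curve_cd : d ^+ 2 + Q.[c] * d = P.[c].
Context (N mu nu : nat) (A B Y : {poly k}).
Hypothesis lt_mu_nu : (mu + g < nu)%N.
Hypothesis le_nu_N : (nu + mu + g <= N)%N.
Hypothesis A_size : (size A <= nu)%N.
Hypothesis B_size : (size B <= mu.+1)%N.
Hypothesis B_neq0 : B != 0.
Hypothesis Y_branch : 'X^N %| Y ^+ 2 + sh Q * Y - sh P.
Hypothesis vanishing : 'X^N %| sh A + sh B * Y.

Lemma coprimep_Xn (p : {poly k}) : p.[0] != 0 -> coprimep 'X^g p.
Proof.
move=> p0; apply: coprimep_expl.
by rewrite coprimep_sym -['X]subr0 -polyC0 coprimep_XsubC.
Qed.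

Lemma dvdXn_leq m n (p : {poly k}) : (m <= n)%N -> 'X^n %| p -> 'X^m %| p.
Proof. by move=> le_mn; apply: dvdp_trans; apply: dvdp_exp2l. Qed.

Lemma dvdp_subXX (h a b : {poly k}) n : h %| a - b -> h %| a ^+ n - b ^+ n.
Proof. by move=> hab; rewrite subrXX dvdp_mulr. Qed.

(** The sum is w^(2n-1) D_n(A + B y) modulo X^g: D_n kills A because deg A < nu <= n,
   and leaves order of vanishing at least N - n >= g. *)
Lemma vanishing_combination n : (nu <= n)%N -> (n <= nu + mu)%N ->
  'X^g %| \sum_(i < mu.+1) (sh B)^`N(i) * sh F ^+ i * sh (sp (s (n - i))).
Proof.
move=> le_nun le_n; pose W := 2%:R * Y + sh Q.
have WF : 'X^g %| W ^+ 2 - sh F.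
  have -> : W ^+ 2 - sh F = 4%:R * (Y ^+ 2 + sh Q * Y - sh P).
    rewrite /W rmorphD rmorphM rmorphXn rmorph_nat /=; ring.
  by apply: dvdp_mull; apply: dvdXn_leq Y_branch; lia.
have shiftN (p : {poly k}) m : (size p <= m)%N -> (sh p)^`N(m) = 0.
  by move=> sp_m; rewrite nderivn_shift nderivn_poly0// comp_poly0.
have E : (sh A + sh B * Y)^`N(n) = \sum_(i < mu.+1) (sh B)^`N(i) * Y^`N(n - i).
  rewrite nderivnD shiftN ?(leq_trans A_size)// add0r nderivnM.
  rewrite [RHS](big_ord_widen n.+1 (fun i => (sh B)^`N(i) * Y^`N(n - i)));
    last by lia.
  rewrite [RHS]big_mkcond; apply: eq_bigr => i _; case: ltnP => // lt_i.
  by rewrite shiftN ?mul0r// (leq_trans B_size).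
have van : 'X^g %| W ^+ (2 * n - 1) * (sh A + sh B * Y)^`N(n).
  apply: dvdp_mull; apply: dvdXn_leq (dvdp_Xn_nderivn n vanishing); lia.
suff : 'X^g %| W ^+ (2 * n - 1) * (sh A + sh B * Y)^`N(n) -
  \sum_(i < mu.+1) (sh B)^`N(i) * sh F ^+ i * sh (sp (s (n - i))).
  by rewrite dvdp_subr.
rewrite E mulr_sumr -sumrB; apply: (big_ind (fun p => 'X^g %| p)).
- exact: dvdp0.
- exact: dvdp_add.
move=> i _; have lt_i := ltn_ord i.
rewrite (_ : W ^+ (2 * n - 1) = W ^+ 2 ^+ i * W ^+ (2 * (n - i) - 1)); last first.
  by rewrite -exprM -exprD; congr (_ ^+ _); lia.
have num : 'X^g %| W ^+ (2 * (n - i) - 1) * Y^`N(n - i) - sh (sp (s (n - i))).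
  apply: dvdXn_leq (branch_numerator sp_nderivn s_natural _ Y_branch); lia.
have := dvdp_subXX i WF; move: num.
move: (sh (sp _)) (W ^+ 2 ^+ i) (sh F ^+ i) (W ^+ _) => a x z v num xz.
rewrite (_ : _ - _ =
  (sh B)^`N(i) * (x * (v * Y^`N(n - i) - a) + (x - z) * a)); last first.
  by move: (sh B)^`N(i) (Y^`N(n - i)) => b y; ring.
by apply/dvdp_mull/dvdp_add; [apply: dvdp_mull | apply: dvdp_mulr].
Qed.

(** The coefficient of the dependence relation that is prime to X. *)
Lemma top_nderivn : B^`N((size B).-1) = (lead_coef B)%:P.
Proof.
apply/polyP => i; rewrite coef_nderivn coefC; case: i => [|i] /=.
  by rewrite addn0 binn mulr1n.
rewrite nth_default ?mul0rn// addnS -addSn prednK ?leq_addr// size_poly_gt0.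
exact: B_neq0.
Qed.

(** The rows of the shifted matrix are linearly dependent modulo X^g, with a
   coefficient prime to X; multiplying by the adjugate gives X^g | det. *)
Lemma det_multiplicity : ('X - c%:P) ^+ g %|
  sp (\det (\matrix_(i < mu.+1, j < mu.+1) s (nu + j - i)%N)).
Proof.
set T := \matrix_(i, j) _.
pose shm : {rmorphism {poly k} -> {poly k}} := comp_poly ('X + c%:P).
pose M := map_mx shm (map_mx sp T).
have detM : \det M = sh (sp (\det T)) by rewrite !det_map_mx.
suff detX : 'X^g %| \det M.
  move: detX; rewrite detM => /dvdpP[r Er]; apply/dvdpP.
  exists (r \Po ('X - c%:P)).
  have := congr1 (fun p => p \Po ('X - c%:P)) Er.
  rewrite -comp_polyA comp_polyD comp_polyX comp_polyC subrK comp_polyXr => ->.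
  by rewrite comp_polyM comp_Xn_poly.
pose r := \row_(i < mu.+1) ((sh B)^`N(i) * sh F ^+ i).
have rM j : 'X^g %| (r *m M) 0 j.
  rewrite mxE; have := @vanishing_combination (nu + j) (leq_addr _ _).
  rewrite leq_add2l -ltnS ltn_ord => /(_ isT); congr (_ %| _).
  by apply: eq_bigr => i _; rewrite !mxE.
have lt_top : ((size B).-1 < mu.+1)%N.
  by rewrite (leq_trans _ B_size)// prednK// size_poly_gt0.
pose i0 := Ordinal lt_top.
have : 'X^g %| r 0 i0 * \det M.
  have -> : r 0 i0 * \det M = (r *m M *m \adj M) 0 i0.
    by rewrite -mulmxA mul_mx_adj mul_mx_scalar [RHS]mxE mulrC.
  rewrite mxE; apply: (big_ind (fun p => 'X^g %| p)).
  - exact: dvdp0.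
  - exact: dvdp_add.
  by move=> j _; apply: dvdp_mulr.
rewrite Gauss_dvdpr//; apply: coprimep_Xn.
rewrite mxE nderivn_shift top_nderivn comp_polyC hornerM hornerC.
rewrite horner_exp horner0_shift mulf_neq0 ?lead_coef_eq0 ?expf_neq0//.
have -> : F.[c] = (2%:R * d + Q.[c]) ^+ 2.
  rewrite hornerD hornerM horner_exp -polyC_natr hornerC -on_curve_cd; ring.
by rewrite expf_neq0.
Qed.

End Multiplicity.

(** * Specialization to the curve *)

Section Specialization.
Context (k : closedFieldType) (g : nat) (E : weierstrass k g).

(** The map on coefficients inside specialize, as a ring morphism. *)
Definition coef_eval : {rmorphism Lambda g -> k} :=
  mmap intr (fun i : 'I_(2 * g + 1 + g.+1) =>
    match split i with inl j => (wP E)`_j | inr j => (wQ E)`_j end).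

Definition specialization : {rmorphism {poly Lambda g} -> {poly k}} :=
  map_poly coef_eval.

Lemma specializeE p : specialize E p = specialization p.
Proof. by []. Qed.

Lemma specialization_nderivn p n :
  specialization p^`N(n) = (specialization p)^`N(n).
Proof. by rewrite /specialization /= nderivn_map. Qed.

Lemma coef_evalX i : coef_eval 'X_i =
  match split i with inl j => (wP E)`_j | inr j => (wQ E)`_j end.
Proof. by rewrite /coef_eval /= mmapX mmap1U. Qed.

Lemma split_lshift m n (i : 'I_m) : split (lshift n i) = inl i.
Proof. exact: (unsplitK (inl i)). Qed.

Lemma split_rshift m n (i : 'I_n) : split (rshift m i) = inr i.
Proof. exact: (unsplitK (inr i)). Qed.

Lemma specialization_univP : specialization (univP g) = wP E.
Proof.
rewrite /univP rmorphD rmorphXn rmorph_sum /= map_polyX.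
under eq_bigr => i _ do
  rewrite rmorphM rmorphXn /= map_polyX map_polyC /= coef_evalX split_lshift
    mul_polyC.
have P_size := wP_size E; have /monicP := wP_monic E.
rewrite lead_coefE P_size /= => P_lead.
rewrite -poly_def; apply/polyP => i; rewrite coefD coefXn coef_poly.
have [lt_i|lt_i|->] := ltngtP i (2 * g + 1)%N; rewrite ?add0r ?addr0//.
by rewrite nth_default// P_size.
Qed.

Lemma specialization_univQ : specialization (univQ g) = wQ E.
Proof.
rewrite /univQ rmorph_sum /=.
under eq_bigr => i _ do
  rewrite rmorphM rmorphXn /= map_polyX map_polyC /= coef_evalX split_rshift
    mul_polyC.
rewrite -poly_def; apply/polyP => i; rewrite coef_poly.
by case: ltnP => // le_i; rewrite nth_default// (leq_trans (wQ_size E)).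
Qed.

End Specialization.

Section DeltaAtTorsion.
Context (k : closedFieldType) (g N : nat) (E : weierstrass k g).
Hypothesis E_smooth : smooth E.
Hypothesis N_ge : (2 * g + 1 <= N)%N.

(** B is nonzero: otherwise A, of degree at most N / 2, would vanish to order N. *)
Lemma delta_multiplicity (a : affine_point E) : curve_torsion E N (Some a) ->
  ('X - (val a).1%:P) ^+ g %| specialize E (Delta g N).
Proof.
move=> tors; have w0 := torsion_unramified E_smooth tors.
have [s [_ s_nat ->//]] := universal_numerators g.
have [A [B [f0 A_bound B_bound [p [q [q0 Epq]]]]]] := torsion_function E_smooth tors.
have on_a := affine_curve a; have sP := specialization_univP E.
have sQ := specialization_univQ E.
have [r Er] : exists r, (A%:P + B%:P * 'X) * q - ('X - (val a).1%:P)%:P ^+ N * p =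
    r * ('X^2 + (wQ E)%:P * 'X - (wP E)%:P).
  apply: (curve_kernel (affine_eq a) (@affine_basis _ _ _ a)).
  rewrite rmorphB !rmorphM rmorphXn rmorphD rmorphM !affine_hC affine_hY Epq.
  exact: subrr.
have [Y [Y0 YN]] := branch_expansion on_a w0 N.
have van := branch_vanishing (affine_eC a) (affine_eY a) Y0 YN q0 Er.
have B_neq0 : B != 0.
  apply: contraNneq f0 => B0; move: van; rewrite B0 comp_poly0 mul0r addr0 => van.
  suff -> : A = 0 by rewrite !rmorph0 mul0r addr0.
  apply/eqP; apply: contraT => A0; have := A_bound A0.
  have shA0 : A \Po ('X + (val a).1%:P) != 0.
    apply: contraNneq A0 => shA0.
    have := congr1 (fun D => D \Po ('X - (val a).1%:P)) shA0.
    rewrite -comp_polyA comp_polyD comp_polyX comp_polyC subrK comp_polyXr.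
    by rewrite comp_poly0 => ->.
  have := dvdp_leq shA0 van; rewrite size_polyXn size_comp_poly2 ?size_XaddC//.
  by move: N_ge; clear; move: (size A) => n; lia.
have A_size : (size A <= nu N)%N.
  have [->|A0] := eqVneq A 0; first by rewrite size_poly0.
  by have := A_bound A0; rewrite /nu; move: (size A) => n; lia.
have B_size : (size B <= (mu g N).+1)%N.
  by have := B_bound B_neq0; rewrite /mu; move: (size B) => n; lia.
have le_nu : (nu N + mu g N + g <= N)%N by move: N_ge; rewrite /mu /nu; lia.
rewrite specializeE; rewrite -sP -sQ in w0 on_a YN van.
exact: (det_multiplicity (specialization_nderivn E) s_nat w0 on_a (mu_g_lt_nu N_ge)
  le_nu A_size B_size B_neq0 YN van).
Qed.

Lemma torsion_abscissa (b : affine_point E) : curve_torsion E N (Some b) ->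
  torsion_x E N (val b).1.
Proof.
move=> tors a ax; have [->|->] := same_abscissa ax; first exact: tors.
exact: torsion_conj.
Qed.

Lemma torsion_x_multiplicity x : torsion_x E N x ->
  ('X - x%:P) ^+ g %| specialize E (Delta g N).
Proof.
move=> tx; have [a ax] := affine_point_over E x.
by rewrite -ax; apply: delta_multiplicity; apply: tx.
Qed.

End DeltaAtTorsion.

Lemma dvdp_prod_XsubC_exp (k : fieldType) (s : seq k) (D : {poly k}) g :
  uniq s -> (forall x, x \in s -> ('X - x%:P) ^+ g %| D) ->
  (\prod_(x <- s) ('X - x%:P)) ^+ g %| D.
Proof.
elim: s => [|x s IH] /=; first by rewrite big_nil expr1n dvd1p.
move=> /andP[x_s uniq_s] dvd; rewrite big_cons exprMn Gauss_dvdp.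
  rewrite dvd ?mem_head// IH// => y y_s; apply: dvd; by rewrite in_cons y_s orbT.
apply: coprimep_expl; apply: coprimep_expr.
by rewrite coprimep_sym coprimep_XsubC root_prod_XsubC.
Qed.

(** * Counting torsion points *)

Section Counting.
Context (k : closedFieldType) (g N : nat) (E : weierstrass k g).
Hypothesis E_smooth : smooth E.
Hypothesis N_ge : (2 * g + 1 <= N)%N.
Hypothesis g_ge1 : (1 <= g)%N.
Local Notation D := (specialize E (Delta g N)).

Lemma torsion_x_finite : D != 0 -> finite_set (torsion_x E N).
Proof.
move=> D0; have [rs Drs] := closed_field_poly_normal D.
apply: (sub_finite_set (B := [set` rs])); last exact: finite_seq.
move=> x /(torsion_x_multiplicity E_smooth N_ge) Dx /=.
have : root D x.
  rewrite -dvdp_XsubCl; apply: dvdp_trans Dx.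
  by rewrite -{1}['X - _]expr1 dvdp_exp2l.
by rewrite Drs rootZ ?lead_coef_eq0// root_prod_XsubC.
Qed.

Lemma tildeU_dvd : tildeU E N ^+ g %| D.
Proof.
have [->|D0] := eqVneq D 0; first exact: dvdp0.
have fin := torsion_x_finite D0.
rewrite /tildeU fsbig_finite//=; apply: dvdp_prod_XsubC_exp.
  exact: fset_uniq.
move=> x; rewrite in_fset_set// inE; exact: torsion_x_multiplicity.
Qed.

Lemma card_torsion_x : D != 0 ->
  (#|` fset_set (torsion_x E N)| * g <= (size D).-1)%N.
Proof.
move=> D0; have fin := torsion_x_finite D0.
have := dvdp_leq D0 tildeU_dvd; rewrite /tildeU fsbig_finite//=.
have U0 : \prod_(x <- fset_set (torsion_x E N)) ('X - x%:P) != 0.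
  by rewrite -size_poly_gt0 size_prod_XsubC.
have := size_exp (\prod_(x <- fset_set (torsion_x E N)) ('X - x%:P)) g.
rewrite size_prod_XsubC /= => <-.
by move=> le_size; rewrite -!subn1 leq_sub2r.
Qed.

(** Over each abscissa lie at most a point and its conjugate; infinity is excluded,
   its class being 0. *)
Lemma card_curve_torsion : finite_set (torsion_x E N) ->
  finite_set (curve_torsion E N) /\
  (#|` fset_set (curve_torsion E N)| <= 2 * #|` fset_set (torsion_x E N)|)%N.
Proof.
move=> fin.
have /boolp.choice[a Ha] := affine_point_over E.
pose pts := [seq Some (a x) | x <- fset_set (torsion_x E N)] ++
  [seq Some (conj_point (a x)) | x <- fset_set (torsion_x E N)].
have sub : (curve_torsion E N `<=` [set` pts])%classic.
  case=> [b tors|/torsion_infinity[]] /=; rewrite mem_cat.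
  have bx : (val b).1 \in fset_set (torsion_x E N).
    by rewrite in_fset_set// inE; apply: torsion_abscissa.
  have [->|->] := same_abscissa (esym (Ha (val b).1)).
    by apply/orP; left; apply: (map_f (fun x => Some (a x))).
  by apply/orP; right; apply: (map_f (fun x => Some (conj_point (a x)))).
have finC : finite_set (curve_torsion E N).
  by apply: sub_finite_set sub _; apply: finite_seq.
split=> //; have -> : (2 * #|` fset_set (torsion_x E N)|)%N = size pts.
  by rewrite size_cat !size_map addnn mul2n.
apply: uniq_leq_size; first exact: fset_uniq.
by move=> xi; rewrite in_fset_set// inE => /sub.
Qed.

Lemma card_curve_torsion_le : D != 0 ->
  finite_set (curve_torsion E N) /\
  (#|` fset_set (curve_torsion E N)| * g <= 2 * (size D).-1)%N.
Proof.
move=> D0; have cardX := card_torsion_x D0.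
have [finC cardC] := card_curve_torsion (torsion_x_finite D0); split=> //.
rewrite (leq_trans (leq_mul cardC (leqnn g)))// -mulnA leq_mul2l cardX.
exact: orbT.
Qed.

End Counting.

Lemma characteristic_natr_neq0 (k : fieldType) (p N : nat) :
  characteristic k p -> p = 0%N \/ (N < p)%N ->
  forall j, (0 < j <= N)%N -> j%:R != 0 :> k.
Proof.
move=> chark p_cond j /andP[j_gt0 le_jN].
case: p chark p_cond => [/pcharf0P char0 _|p charp [//|lt_Np]].
  by rewrite char0 -lt0n.
rewrite -(dvdn_pcharf charp); apply/negP => /(dvdn_leq j_gt0).
by move=> /(leq_trans lt_Np); rewrite ltnNge le_jN.
Qed.

(** The leading coefficient lives in the domain Lambda and is tested in its field of
   fractions, of characteristic 0. *)
Lemma size_Delta g N : (1 <= g)%N -> (2 * g + 1 <= N)%N ->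
  size (Delta g N) = (delta g N).+1.
Proof.
move=> g_ge1 N_ge; have [s [s_sqrt _ ->//]] := universal_numerators g.
have [size_le top] := toeplitz_top s_sqrt N_ge.
have natr_neq0 j : (0 < j <= N)%N -> j%:R != 0 :> {fraction Lambda g}.
  case: j => // j _; rewrite -(rmorph_nat (@FracField.tofrac (Lambda g))).
  by rewrite tofrac_eq0 Lambda_succ_neq0.
have := toeplitz_leading_neq0 s_sqrt (@FracField.tofrac (Lambda g)) g_ge1 N_ge
  natr_neq0.
rewrite tofrac_eq0 -top => lead_neq0; apply/eqP; rewrite eqn_leq size_le /=.
by rewrite ltnNge; apply: contra lead_neq0 => le_size; rewrite nth_default.
Qed.

(** The coefficient of degree delta commutes with specialization, and the assumption
   on the integers up to N makes it nonzero in k. *)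
Lemma size_specialize_Delta (k : closedFieldType) g N (E : weierstrass k g) :
  (1 <= g)%N -> (2 * g + 1 <= N)%N ->
  (forall j, (0 < j <= N)%N -> j%:R != 0 :> k) ->
  size (specialize E (Delta g N)) = (delta g N).+1.
Proof.
move=> g_ge1 N_ge natr_neq0.
have size_le : (size (specialize E (Delta g N)) <= (delta g N).+1)%N.
  by rewrite -size_Delta//; apply: size_poly.
have [s [s_sqrt _ DeltaE]] := universal_numerators g.
have [_ top] := toeplitz_top s_sqrt N_ge.
have := toeplitz_leading_neq0 s_sqrt (coef_eval E) g_ge1 N_ge natr_neq0.
rewrite -top -DeltaE// => lead_neq0; apply/eqP; rewrite eqn_leq size_le /=.
rewrite ltnNge; apply: contra lead_neq0 => le_size.
by rewrite -(coef_map (coef_eval E)) nth_default.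
Qed.

Lemma double_delta g N : (2 * g + 1 <= N)%N ->
  (2 * delta g N = g * (if odd N then (N + 1) * (N - 2 * g + 1)
    else (N + 2) * (N - 2 * g)))%N.
Proof.
move=> N_ge; rewrite deltaE// /mu /nu; have := odd_double_half N.
case: (odd N) => /= E0.
  have -> : (N + 1 = 2 * (N %/ 2).+1)%N by lia.
  have -> : (N - 2 * g + 1 = 2 * ((N - (2 * g + 1)) %/ 2).+1)%N by lia.
  by lia.
have -> : (N + 2 = 2 * (N %/ 2).+1)%N by lia.
have -> : (N - 2 * g = 2 * ((N - (2 * g + 1)) %/ 2).+1)%N by lia.
by lia.
Qed.

Theorem theorem1p2 (k : closedFieldType) (p g N : nat)
    (k_char : characteristic k p) (g_ge1 : (1 <= g)%N)
    (N_ge : (2 * g + 1 <= N)%N)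
    (E : weierstrass k g) (E_smooth : smooth E) :
  (* (a) *)
  [/\ size (Delta g N) = (delta g N).+1,
      (size (specialize E (Delta g N)) <= (delta g N).+1)%N
    & tildeU E N ^+ g %| specialize E (Delta g N)]
  /\
  (* (b) *)
  (specialize E (Delta g N) != 0 ->
    finite_set (curve_torsion E N) /\
    (#|` fset_set (curve_torsion E N)|%:R <=
       2 * ((size (specialize E (Delta g N))).-1%:R / g%:R) :> rat))
  /\
  (* (c) *)
  (p = 0%N \/ (N < p)%N ->
    [/\ size (specialize E (Delta g N)) = (delta g N).+1,
        specialize E (Delta g N) != 0,
        finite_set (curve_torsion E N)
      & (#|` fset_set (curve_torsion E N)| <=
          if odd N then (N + 1) * (N - 2 * g + 1)
          else (N + 2) * (N - 2 * g))%N]).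
Proof.
have sizeD := size_Delta g_ge1 N_ge.
split; [split=> // | split].
- by rewrite -sizeD; apply: size_poly.
- exact: tildeU_dvd.
- move=> D0; have [finC cardC] := card_curve_torsion_le E_smooth N_ge g_ge1 D0.
  split=> //; rewrite mulrA ler_pdivlMr ?ltr0n// -!natrM ler_nat.
  exact: cardC.
move=> p_cond.
have sizeS := size_specialize_Delta E g_ge1 N_ge
  (characteristic_natr_neq0 k_char p_cond).
have D0 : specialize E (Delta g N) != 0 by rewrite -size_poly_gt0 sizeS.
have [finC cardC] := card_curve_torsion_le E_smooth N_ge g_ge1 D0; split=> //.
rewrite -(leq_pmul2l g_ge1) -double_delta// mulnC (leq_trans cardC)//.
by rewrite sizeS.
Qed.
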